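(* Let $\ell'\in\frac12\mathbf{Z}$. There are positive constants $A_{\ell'},B_{\ell'}$, depending only on $\ell'$, such that the following holds. Let $\varphi$ be a cuspidal automorphic form on $\mathrm{SL}_2(\mathbf{A})$ or $\widetilde{\mathrm{SL}_2}(\mathbf{A})$ corresponding to a holomorphic modular form of weight $\ell'$, with Fourier expansion $\varphi(g)=\sum_{d\in\mathbf{Q}_{>0}}b_d(g_f)\mathcal{W}_{\ell',d}(g_\infty)$. Let $M\ge1$ be an integer such that $b_d(k)\neq0$ for some $k\in\widetilde K$ implies $d\in M^{-1}\mathbf{Z}$, and let $\beta_d(g_f)=d^{-\ell'/2}b_d(g_f)$. Let $\epsilon\ge0$ and suppose $|\beta_d(k)|\le\epsilon$ for all $d<R:=\log(M)/\pi+A_{\ell'}$ and all $k\in\widetilde K$. Then $|\beta_d(g_f)|\le\epsilon B_{\ell'}M$ for all $d$ and all $g_f$ (in $\mathrm{SL}_2(\mathbf{A}_f)$, resp. $\widetilde{\mathrm{SL}_2}(\mathbf{A}_f)$).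
   Context: $\widetilde{\mathrm{SL}_2}$ denotes the metaplectic double cover. For $g_\infty$ in $\mathrm{SL}_2(\mathbf{R})$ or $\widetilde{\mathrm{SL}_2}(\mathbf{R})$ with image $\begin{pmatrix}a&b\\c&d\end{pmatrix}\in\mathrm{SL}_2(\mathbf{R})$, let $j_{1/2}(g_\infty,z)$ be the canonical square root of $cz+d$ for $z$ in the upper half plane, and $\mathcal{W}_{\ell',n}(g_\infty)=j_{1/2}(g_\infty,i)^{-2\ell'}e^{2\pi in(g_\infty\cdot i)}$. $\widetilde K$ is $\mathrm{SL}_2(\widehat{\mathbf{Z}})$ in the $\mathrm{SL}_2$ case, and its inverse image in $\widetilde{\mathrm{SL}_2}(\mathbf{A}_f)$ in the metaplectic case. $\varphi$ is scalar valued; ''corresponding to a holomorphic modular form of weight $\ell'$'' means it has a Fourier expansion of the stated form. *)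

(* Defs.v *)
From HB Require Import structures.
From mathcomp Require Import all_boot all_order all_algebra.
From mathcomp Require Import generic_quotient ring_quotient.
From mathcomp Require Import finmap.
From mathcomp Require Import all_classical all_reals all_analysis.
From mathcomp Require Import complex ring.
From mathcomp.analysis.showcase Require summability.
Import Order.TTheory GRing.Theory Num.Theory.
Import numFieldNormedType.Exports.

Set Implicit Arguments.
Unset Strict Implicit.
Unset Printing Implicit Defensive.

Local Open Scope classical_set_scope.
Local Open Scope ring_scope.
Local Open Scope complex_scope.
Local Open Scope quotient_scope.

Definition prime_nat := {p : nat | prime p}.

(* q \in p^n Z_(p) *)
Definition padic_ball (p n : nat) (q : rat) : Prop :=
  exists (a : int) (s : nat),
    [/\ (0 < s)%N, coprime p s & q * s%:R = (p ^ n)%:R * a%:~R].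

Definition padic_cauchy (p : nat) (u : nat -> rat) : Prop :=
  forall n : nat, exists k : nat, forall i j : nat,
    (k <= i)%N -> (k <= j)%N -> padic_ball p n (u i - u j).

Definition padic_null (p : nat) (u : nat -> rat) : Prop :=
  forall n : nat, exists k : nat, forall i : nat,
    (k <= i)%N -> padic_ball p n (u i).

Section PadicBall.
Variable p : nat.

Lemma padic_ball0 n : padic_ball p n 0.
Proof. by exists 0, 1%N; rewrite coprimen1 mul0r mulr0. Qed.

Lemma padic_ballB n q r :
  padic_ball p n q -> padic_ball p n r -> padic_ball p n (q - r).
Proof.
move=> [a [s [s0 cs qE]]] [b [t [t0 ct rE]]].
exists (a * t%:Z - b * s%:Z), (s * t)%N; split; first by rewrite muln_gt0 s0.
  by rewrite coprimeMr cs.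
rewrite natrM mulrBl mulrA qE [s%:R * _]mulrC mulrA rE rmorphB !rmorphM /=.
by rewrite mulrBr !mulrA.
Qed.

Lemma padic_ballN n q : padic_ball p n q -> padic_ball p n (- q).
Proof. by rewrite -[- q]add0r; apply: padic_ballB; exact: padic_ball0. Qed.

Lemma padic_ballD n q r :
  padic_ball p n q -> padic_ball p n r -> padic_ball p n (q + r).
Proof. by move=> hq /padic_ballN; rewrite -{2}[r]opprK; exact: padic_ballB. Qed.

Lemma padic_ballM m n q r :
  padic_ball p m q -> padic_ball p n r -> padic_ball p (m + n) (q * r).
Proof.
move=> [a [s [s0 cs qE]]] [b [t [t0 ct rE]]].
exists (a * b), (s * t)%N; split; first by rewrite muln_gt0 s0.
  by rewrite coprimeMr cs.
by rewrite natrM mulrACA qE rE expnD natrM rmorphM mulrACA.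
Qed.

Lemma padic_ball_le m n q : (m <= n)%N -> padic_ball p n q -> padic_ball p m q.
Proof.
move=> mn [a [s [s0 cs qE]]].
exists ((p ^ (n - m))%N%:Z * a), s; split => //.
by rewrite qE rmorphM /= mulrA -pmulrn -natrM -expnD subnKC.
Qed.

Lemma padic_ball_cancel m n q : (0 < p)%N ->
  padic_ball p (m + n) ((p ^ m)%:R * q) -> padic_ball p n q.
Proof.
move=> p0 [a [s [s0 cs qE]]]; exists a, s; split => //.
have pm0 : (p ^ m)%:R != 0 :> rat by rewrite pnatr_eq0 -lt0n expn_gt0 p0.
by apply: (mulfI pm0); rewrite mulrA qE expnD natrM mulrA.
Qed.

Lemma padic_ball_denom q : prime p -> exists e, padic_ball p 0 ((p ^ e)%:R * q).
Proof.
move=> pp; pose d := `|denq q|%N; exists (logn p d).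
have d0 : (0 < d)%N by rewrite absz_gt0 denq_neq0.
have [s cs dE] := pfactor_coprime pp d0.
have s0 : (0 < s)%N by move: d0; rewrite dE muln_gt0 => /andP[].
exists (numq q), s; split => //; rewrite expn0 mul1r mulrAC -natrM mulnC -dE.
by rewrite numqE mulrC pmulrn /d absz_denq.
Qed.

Lemma padic_ballMl e n q r : (0 < p)%N ->
  padic_ball p 0 ((p ^ e)%:R * q) -> padic_ball p (e + n) r ->
  padic_ball p n (q * r).
Proof.
move=> p0 hq hr; apply: (@padic_ball_cancel e) => //; rewrite mulrA.
exact: (padic_ballM hq hr).
Qed.

Lemma padic_not_ball1 : prime p -> ~ padic_ball p 1 1.
Proof.
move=> pp [a [s [s0 cs]]]; rewrite mul1r expn1 pmulrn -!(intrM _ p a).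
move=> /intr_inj sE; have : (p %| s)%N.
  by rewrite -[s]/(`|s%:Z|%N) sE abszM dvdn_mulr.
by move: cs; rewrite prime_coprime // => /negP.
Qed.

Lemma padic_cauchy_bounded u : prime p -> padic_cauchy p u ->
  exists e k, forall i, (k <= i)%N -> padic_ball p 0 ((p ^ e)%:R * u i).
Proof.
move=> pp cu; have [k hk] := cu 0%N; have [e he] := padic_ball_denom (u k) pp.
exists e, k => i ki; rewrite -[u i](subrK (u k)) mulrDr; apply: padic_ballD => //.
apply: (@padic_ballM 0 0); last exact: hk.
by exists (p ^ e)%N%:Z, 1%N; rewrite coprimen1 mulr1 expn0 mul1r.
Qed.

Lemma padic_ballV n q : prime p -> ~ padic_ball p n q ->
  q != 0 /\ padic_ball p 0 ((p ^ n)%:R * q^-1).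
Proof.
move=> pp nq; have q0 : q != 0.
  by apply/eqP => qE; apply: nq; rewrite qE; exact: padic_ball0.
split=> //; have p0 := prime_gt0 pp.
have pX0 m : (p ^ m)%:R != 0 :> rat by rewrite pnatr_eq0 -lt0n expn_gt0 p0.
have [e [a [s [s0 cs]]]] := padic_ball_denom q pp; rewrite expn0 mul1r => aE.
have s0' : s%:R != 0 :> rat by rewrite pnatr_eq0 -lt0n.
have a0 : a != 0.
  by rewrite -(intr_eq0 rat) -aE mulf_neq0 ?mulf_neq0.
have aa0 : (0 < `|a|)%N by rewrite absz_gt0.
have [t ct tE] := pfactor_coprime pp aa0.
have t0 : (0 < t)%N by move: aa0; rewrite tE muln_gt0 => /andP[].
have t0' : t%:R != 0 :> rat by rewrite pnatr_eq0 -lt0n.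
set k := logn p `|a|%N in tE.
have aE' : a%:~R = (p ^ k)%:R * ((-1) ^+ (a < 0)%R * t%:R) :> rat.
  rewrite {1}[a]intEsign tE rmorphM rmorphXn /= rmorphN1 -pmulrn natrM.
  by ring.
have kn : (k <= n + e)%N.
  rewrite leqNgt; apply/negP => kn; apply: nq.
  apply: (@padic_ball_cancel e) => //; apply: (@padic_ball_le _ k).
    by rewrite addnC ltnW.
  exists ((-1) ^+ (a < 0)%R * t%:Z), s; split=> //.
  by rewrite aE aE' rmorphM /= rmorph_sign.
exists ((-1) ^+ (a < 0)%R * (p ^ (n + e - k))%N%:Z * s%:Z), t; split=> //.
rewrite expn0 mul1r !rmorphM /= rmorph_sign -!pmulrn.
have e0 : (-1) ^+ (a < 0)%R != 0 :> rat by rewrite signr_eq0.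
apply: (mulIf q0); rewrite mulrAC mulfVK //; apply: (mulIf (pX0 e)).
set g := (-1) ^+ _; set x := (p ^ (n + e - k))%:R.
have -> : g * x * s%:R * q * (p ^ e)%:R = g * x * ((p ^ e)%:R * q * s%:R) by ring.
have gg : g * g = 1 by rewrite -expr2 sqrr_sign.
have xE : x * (p ^ k)%:R = (p ^ n)%:R * (p ^ e)%:R by rewrite -!natrM -!expnD subnK.
rewrite aE aE' -/g.
have -> : g * x * ((p ^ k)%:R * (g * t%:R)) =
          g * g * (x * (p ^ k)%:R) * t%:R by ring.
by rewrite gg xE; ring.
Qed.

Lemma padic_cauchyV u : prime p -> padic_cauchy p u -> ~ padic_null p u ->
  exists2 v, padic_cauchy p v & padic_null p (v * u - 1).
Proof.
move=> pp cu /existsNP[n /forallNP nu]; have p0 := prime_gt0 pp.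
have [k0 hk0] := cu n.
have hu i : (k0 <= i)%N -> u i != 0 /\ padic_ball p 0 ((p ^ n)%:R * (u i)^-1).
  move=> ki; apply: padic_ballV => // bi; apply: (nu k0) => j kj.
  by rewrite -[u j](subrK (u i)); apply: padic_ballD => //; exact: hk0.
exists (fun i => (u i)^-1).
  move=> m; have [k hk] := cu (n + (n + m))%N.
  exists (maxn k0 k) => i j; rewrite !geq_max => /andP[ki li] /andP[kj lj].
  have [ui0 bi] := hu _ ki; have [uj0 bj] := hu _ kj.
  have -> : (u i)^-1 - (u j)^-1 = (u i)^-1 * ((u j)^-1 * (u j - u i)).
    by move: (u i) (u j) ui0 uj0 => a b a0 b0; field; rewrite a0 b0.
  by apply: (padic_ballMl p0 bi); apply: (padic_ballMl p0 bj); exact: hk.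
move=> m; exists k0 => i ki; have [ui0 _] := hu _ ki.
have -> : ((fun i => (u i)^-1) * u - 1) i = (u i)^-1 * u i - 1 by [].
by rewrite mulVf // subrr; exact: padic_ball0.
Qed.

Lemma padic_cauchyM u v : prime p ->
  padic_cauchy p u -> padic_cauchy p v -> padic_cauchy p (u * v).
Proof.
move=> pp cu cv n; have p0 := prime_gt0 pp.
have [e [k hk]] := padic_cauchy_bounded pp cu.
have [f [l hl]] := padic_cauchy_bounded pp cv.
have [k' hk'] := cv (e + n)%N; have [l' hl'] := cu (f + n)%N.
exists (maxn (maxn k l) (maxn k' l')) => i j.
rewrite !geq_max => /andP[/andP[ki li] /andP[k'i l'i]].
move=> /andP[/andP[kj lj] /andP[k'j l'j]].
have -> : (u * v) i - (u * v) j = u i * (v i - v j) + v j * (u i - u j).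
  have E (a b c d : rat) : a * c - b * d = a * (c - d) + d * (a - b) by ring.
  exact: E.
apply: padic_ballD; first exact: padic_ballMl (hk _ _) (hk' _ _ _ _).
exact: padic_ballMl (hl _ _) (hl' _ _ _ _).
Qed.

End PadicBall.

Section PadicRing.
Variable p : prime_nat.

Definition padic_cauchyb : {pred nat -> rat} :=
  fun u => `[< padic_cauchy (val p) u >].

Lemma padic_cauchy_cst q : padic_cauchy (val p) (fun=> q).
Proof. by move=> n; exists 0%N => i j _ _; rewrite subrr; exact: padic_ball0. Qed.

Lemma padic_cauchyb_subring : subring_closed padic_cauchyb.
Proof.
split=> [|u v /asboolP cu /asboolP cv|u v /asboolP cu /asboolP cv]; apply/asboolP.
- exact: padic_cauchy_cst.
- move=> n; have [k hk] := cu n; have [l hl] := cv n.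
  exists (maxn k l) => i j; rewrite !geq_max => /andP[ki li] /andP[kj lj].
  have -> : (u - v) i - (u - v) j = (u i - u j) - (v i - v j).
    have E (a b c d : rat) : (a - c) - (b - d) = (a - b) - (c - d) by ring.
    exact: E.
  by apply: padic_ballB; [exact: hk|exact: hl].
- exact: (padic_cauchyM (valP p)).
Qed.

HB.instance Definition _ :=
  GRing.isSubringClosed.Build _ padic_cauchyb padic_cauchyb_subring.

Record padic_seq := PadicSeq {
  padic_seq_val :> nat -> rat;
  padic_seqP : padic_seq_val \in padic_cauchyb }.

HB.instance Definition _ := [isSub for padic_seq_val].
HB.instance Definition _ := [Choice of padic_seq by <:].
HB.instance Definition _ := [SubChoice_isSubComNzRing of padic_seq by <:].

Definition padic_nullb : {pred padic_seq} := fun u => `[< padic_null (val p) u >].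

Lemma padic_nullb_idealr : idealr_closed padic_nullb.
Proof.
split.
- by apply/asboolP => n; exists 0%N => i _; exact: padic_ball0.
- apply/negP => /asboolP /(_ 1%N)[k /(_ k (leqnn k))].
  exact: padic_not_ball1 (valP p).
- move=> a u v /asboolP nu /asboolP nv; apply/asboolP => n.
  have /asboolP ca := padic_seqP a; have p0 := prime_gt0 (valP p).
  have [e [k hk]] := padic_cauchy_bounded (valP p) ca.
  have [l hl] := nu (e + n)%N; have [m hm] := nv n.
  exists (maxn k (maxn l m)) => i; rewrite !geq_max => /and3P[ki li mi].
  apply: padic_ballD; last exact: hm.
  exact: padic_ballMl (hk _ ki) (hl _ li).
Qed.

HB.instance Definition _ := isIdealr.Build _ padic_nullb padic_nullb_idealr.

(* p-adic Cauchy sequences of rationals modulo null sequences *)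
Definition Qp := {ideal_quot padic_nullb}.
HB.instance Definition _ := GRing.ComNzRing.on Qp.

Lemma Qp_inv_ex (x : Qp) : x != 0 -> exists y : Qp, y * x = 1.
Proof.
have /asboolP cu := padic_seqP (repr x).
rewrite -[x]reprK; set u := repr x in cu *; move=> u0.
have nu : ~ padic_null (val p) u.
  move=> nu; case/eqP: u0; apply/eqP.
  rewrite -[0]/(0 : {ideal_quot padic_nullb}) piE Quotient.equivE subr0.
  exact/asboolP.
have [v cv nvu] := padic_cauchyV (valP p) cu nu.
pose w := PadicSeq (introT (asboolP _) cv : v \in padic_cauchyb).
exists (\pi_{ideal_quot padic_nullb} w); apply/eqP.
by rewrite -[1]/(1 : {ideal_quot padic_nullb}) piE Quotient.equivE; exact/asboolP.
Qed.

Definition Qp_inv (x : Qp) : Qp := xget 0 [set y | y * x = 1].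

Lemma Qp_mulVf (x : Qp) : x != 0 -> Qp_inv x * x = 1.
Proof.
by move=> /Qp_inv_ex[y yx]; rewrite /Qp_inv; case: xgetP => [_ -> //|/(_ y)].
Qed.

Lemma Qp_inv0 : Qp_inv 0 = 0.
Proof.
rewrite /Qp_inv; case: xgetP => // y _ /= /eqP.
by rewrite mulr0 eq_sym oner_eq0.
Qed.

HB.instance Definition _ := GRing.ComNzRing_isField.Build Qp Qp_mulVf Qp_inv0.

Definition Qp_of_seq (u : padic_seq) : Qp := \pi_{ideal_quot padic_nullb} u.

Definition padic_cst (q : rat) : padic_seq :=
  PadicSeq (introT (asboolP _) (padic_cauchy_cst q)).

Definition Qp_of_rat (q : rat) : Qp := Qp_of_seq (padic_cst q).

Lemma Qp_of_rat_zmod : zmod_morphism Qp_of_rat.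
Proof.
move=> q r; rewrite /Qp_of_rat /Qp_of_seq.
by rewrite -(rmorphB (\pi_{ideal_quot padic_nullb})); congr (\pi _); exact: val_inj.
Qed.

Lemma Qp_of_rat_monoid : monoid_morphism Qp_of_rat.
Proof.
split=> [|q r]; rewrite /Qp_of_rat /Qp_of_seq.
  by rewrite -(rmorph1 (\pi_{ideal_quot padic_nullb})); congr (\pi _); exact: val_inj.
by rewrite -(rmorphM (\pi_{ideal_quot padic_nullb})); congr (\pi _); exact: val_inj.
Qed.

HB.instance Definition _ :=
  GRing.isZmodMorphism.Build rat Qp Qp_of_rat Qp_of_rat_zmod.
HB.instance Definition _ :=
  GRing.isMonoidMorphism.Build rat Qp Qp_of_rat Qp_of_rat_monoid.

Definition padic_int : set Qp :=
  [set x | exists2 u : padic_seq, (forall i, padic_ball (val p) 0 (u i)) &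
                                  x = Qp_of_seq u].

Lemma padic_int_of_rat q : padic_ball (val p) 0 q -> padic_int (Qp_of_rat q).
Proof. by move=> hq; exists (padic_cst q). Qed.

Lemma padic_intD x y : padic_int x -> padic_int y -> padic_int (x + y).
Proof.
move=> [u hu ->] [v hv ->]; exists (u + v).
  by move=> i; exact: (padic_ballD (hu i) (hv i)).
by rewrite /Qp_of_seq -(rmorphD (\pi_{ideal_quot padic_nullb})).
Qed.

Lemma padic_intM x y : padic_int x -> padic_int y -> padic_int (x * y).
Proof.
move=> [u hu ->] [v hv ->]; exists (u * v).
  by move=> i; exact: (@padic_ballM _ 0 0 _ _ (hu i) (hv i)).
by rewrite /Qp_of_seq -(rmorphM (\pi_{ideal_quot padic_nullb})).
Qed.

(* the valuation of x is an odd integer *)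
Definition odd_ord (x : Qp) : Prop :=
  exists (m : int) (u : Qp),
    [/\ padic_int u, padic_int u^-1, u != 0 & x = Qp_of_rat ((val p)%:R ^ (2 * m + 1)) * u].

(* {+1, -1} is encoded by bool, with true standing for -1; the symbol (a, b)_p
   is +1 iff a x^2 + b y^2 = z^2 has a nontrivial solution. *)
Definition hilbert_symbol (a b : Qp) : bool :=
  ~~ `[< exists x y z : Qp, (x, y, z) != (0, 0, 0) /\
           a * x ^+ 2 + b * y ^+ 2 = z ^+ 2 >].

End PadicRing.

Section SL2.
Variable A : comNzRingType.

Definition SL2 := {g : 'M[A]_2 | \det g == 1}.

Coercion SL2_mx (g : SL2) : 'M[A]_2 := sval g.

Lemma SL2_det (g : SL2) : \det g = 1. Proof. exact/eqP/(valP g). Qed.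

Lemma SL2_mul_subproof (g h : SL2) : \det (g *m h) == 1.
Proof. by rewrite det_mulmx !SL2_det mulr1. Qed.

Definition SL2_mul (g h : SL2) : SL2 := exist _ (g *m h) (SL2_mul_subproof g h).

Lemma SL2_one_subproof : \det (1%:M : 'M[A]_2) == 1.
Proof. by rewrite det1. Qed.

Definition SL2_one : SL2 := exist _ 1%:M SL2_one_subproof.

Definition mx2 (a b c d : A) : 'M[A]_2 :=
  \matrix_(i < 2, j < 2)
    if i == 0 then (if j == 0 then a else b) else (if j == 0 then c else d).

Lemma det_mx2 a b c d : \det (mx2 a b c d) = a * d - b * c.
Proof.
rewrite (expand_det_row _ 0) big_ord_recl big_ord1 /cofactor !det_mx11 !mxE /=.
by rewrite expr0 expr1 mul1r mulN1r mulrN.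
Qed.

End SL2.

Lemma SL2_map_subproof (A B : comNzRingType) (f : {rmorphism A -> B}) (g : SL2 A) :
  \det (map_mx f g) == 1.
Proof. by rewrite det_map_mx SL2_det rmorph1. Qed.

Definition SL2_map (A B : comNzRingType) (f : {rmorphism A -> B}) (g : SL2 A) :
  SL2 B := exist _ (map_mx f g) (SL2_map_subproof f g).

Definition SL2_Zp (p : prime_nat) : set (SL2 (Qp p)) :=
  [set g | forall i j, padic_int (g i j)].

(* restricted product of the SL_2(Q_p) with respect to the SL_2(Z_p) *)
Record SL2Af := MkSL2Af {
  SL2Af_comp :> forall p : prime_nat, SL2 (Qp p);
  SL2Af_restricted : finite_set [set p | ~ SL2_Zp (SL2Af_comp p)] }.

Lemma SL2Af_mul_subproof (g h : SL2Af) :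
  finite_set [set p | ~ SL2_Zp (SL2_mul (g p) (h p))].
Proof.
apply: (@sub_finite_set _ _
  ([set p | ~ SL2_Zp (g p)] `|` [set p | ~ SL2_Zp (h p)])); last first.
  by rewrite finite_setU; split; exact: SL2Af_restricted.
move=> p /= ngh; apply: contrapT => /not_orP[/contrapT hg /contrapT hh].
apply: ngh => i j; rewrite /= mxE big_ord_recl big_ord1.
by apply: padic_intD; apply: padic_intM; [exact: hg|exact: hh|exact: hg|exact: hh].
Qed.

Definition SL2Af_mul (g h : SL2Af) : SL2Af := MkSL2Af (SL2Af_mul_subproof g h).

Lemma SL2Af_of_Q_subproof (g : SL2 rat) :
  finite_set [set p | ~ SL2_Zp (SL2_map (Qp_of_rat p) g)].
Proof.
pose D := (\prod_i \prod_j `|denq (g i j)|)%N.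
have D0 : (0 < D)%N.
  rewrite !prodn_gt0 // => i; rewrite prodn_gt0 // => j.
  by rewrite absz_gt0 denq_neq0.
apply: (@sub_finite_set _ _ (val @^-1` `I_D.+1)) => [p /= np|]; last first.
  by apply: finite_preimage; [move=> x y _ _; exact: val_inj|exact: finite_II].
rewrite ltnS leqNgt; apply/negP => Dp; apply: np => i j; rewrite /= mxE.
apply: padic_int_of_rat; exists (numq (g i j)), `|denq (g i j)|%N; split.
- by rewrite absz_gt0 denq_neq0.
- rewrite prime_coprime ?(valP p) //; apply/negP => pd.
  have : (val p %| D)%N.
    apply: dvdn_trans pd _; rewrite /D (bigD1 i) //= (bigD1 j) //= -mulnA.
    exact: dvdn_mulr.
  by move=> /(dvdn_leq D0); rewrite leqNgt Dp.
- by rewrite expn0 mul1r numqE pmulrn absz_denq.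
Qed.

Definition SL2Af_of_Q (g : SL2 rat) : SL2Af := MkSL2Af (SL2Af_of_Q_subproof g).

Lemma SL2Af_one_subproof :
  finite_set [set p | ~ SL2_Zp (SL2_one (Qp p))].
Proof.
rewrite (_ : [set _ | _] = set0) //; apply/seteqP; split=> // p /=; apply=> i j.
rewrite mxE -[_%:R](rmorph_nat (Qp_of_rat p)); apply: padic_int_of_rat.
by exists (i == j)%:Z, 1%N; rewrite coprimen1 mulr1 mul1r; case: (i == j).
Qed.

Definition SL2Af_one : SL2Af := MkSL2Af SL2Af_one_subproof.

Definition SL2_Zhat : set SL2Af := [set g : SL2Af | forall p, SL2_Zp (g p)].

(* principal congruence subgroup of level N; these form a neighbourhood basis of
   the identity in SL_2(A_f) *)
Definition congruence_subgroup (N : nat) : set SL2Af :=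
  [set g : SL2Af | forall (p : prime_nat) (i j : 'I_2),
     exists2 z : Qp p, padic_int z & g p i j - (i == j)%:R = N%:R * z].

Section Kubota.
Variable p : prime_nat.
Implicit Types g h : SL2 (Qp p).

Definition kubota_x g : Qp p := if g 1 0 != 0 then g 1 0 else g 1 1.

Definition kubota_alpha g h : bool :=
  hilbert_symbol (kubota_x (SL2_mul g h) / kubota_x g)
                 (kubota_x (SL2_mul g h) / kubota_x h).

Definition kubota_s g : bool :=
  [&& g 1 0 != 0, g 1 1 != 0, `[< odd_ord (g 1 0) >] &
      hilbert_symbol (g 1 0) (g 1 1)].

(* Kubota's 2-cocycle, normalised to be trivial on SL_2(Z_p) for p odd and on
   {a = 1, c = 0 mod 4} for p = 2 *)
Definition kubota_cocycle g h : bool :=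
  kubota_alpha g h (+) kubota_s g (+) kubota_s h (+) kubota_s (SL2_mul g h).

End Kubota.

(* almost all factors are trivial *)
Definition finite_cocycle (g h : SL2Af) : bool :=
  \big[addb/false]_(p \in [set: prime_nat]) kubota_cocycle (g p) (h p).

Section RealPlace.
Variable R : realType.
Implicit Types g h : SL2 R.

Definition SL2_act g (z : R[i]) : R[i] :=
  ((g 0 0)%:C * z + (g 0 1)%:C) / ((g 1 0)%:C * z + (g 1 1)%:C).

(* principal square root of cz + d; it is continuous in z on the upper half plane *)
Definition principal_j g (z : R[i]) : R[i] :=
  sqrtc ((g 1 0)%:C * z + (g 1 1)%:C).

(* sign relating the two square roots of the automorphy factor of gh; it does not
   depend on the point z at which they are compared *)
Definition real_cocycle g h : bool :=
  principal_j g (SL2_act h 'i) * principal_j h 'i != principal_j (SL2_mul g h) 'i.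

Lemma upper_subproof (x : R) : \det (mx2 1 x 0 1) == 1.
Proof. by rewrite det_mx2 mulr1 mulr0 subr0. Qed.
Lemma lower_subproof (x : R) : \det (mx2 1 0 x 1) == 1.
Proof. by rewrite det_mx2 mulr1 mul0r subr0. Qed.
Lemma torus_subproof (x : R) : \det (mx2 (expR x) 0 0 (expR (- x))) == 1.
Proof. by rewrite det_mx2 mulr0 subr0 -expRD subrr expR0. Qed.

Definition upper (x : R) : SL2 R := exist _ (mx2 1 x 0 1) (upper_subproof x).
Definition lower (x : R) : SL2 R := exist _ (mx2 1 0 x 1) (lower_subproof x).
Definition torus (x : R) : SL2 R :=
  exist _ (mx2 (expR x) 0 0 (expR (- x))) (torus_subproof x).

Definition cexp (z : R[i]) : R[i] :=
  (expR (complex.Re z))%:C * (cos (complex.Im z) +i* sin (complex.Im z)).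

End RealPlace.

(* Gfin, Ginf and Gad are the points over A_f, R and A; adjoin is the product map
   Gfin x Ginf -> Gad.  The sections lift_fin and lift_inf are not homomorphisms
   in the metaplectic case. *)
Record adelic_group (R : realType) := AdelicGroup {
  Gfin : Type;
  Ginf : Type;
  Gad : Type;
  gmul : Gad -> Gad -> Gad;
  adjoin : Gfin -> Ginf -> Gad;
  proj_fin : Gfin -> SL2Af;
  proj_inf : Ginf -> SL2 R;
  lift_fin : SL2Af -> Gfin;
  lift_inf : SL2 R -> Ginf;
  jhalf : Ginf -> R[i] -> R[i] }.

Definition linear_SL2 (R : realType) : adelic_group R := {|
  Gfin := SL2Af;
  Ginf := SL2 R;
  Gad := SL2Af * SL2 R;
  gmul g h := (SL2Af_mul g.1 h.1, SL2_mul g.2 h.2);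
  adjoin gf gi := (gf, gi);
  proj_fin gf := gf;
  proj_inf gi := gi;
  lift_fin gf := gf;
  lift_inf gi := gi;
  jhalf gi z := principal_j gi z |}.

(* The double covers of SL_2(A_f), SL_2(R) and SL_2(A) are the sets of pairs
   (g, sign) with the product twisted by the respective cocycle; that of SL_2(A) is
   the quotient of the product of the other two by the diagonal {+1, -1}. *)
Definition metaplectic_SL2 (R : realType) : adelic_group R := {|
  Gfin := SL2Af * bool;
  Ginf := SL2 R * bool;
  Gad := (SL2Af * SL2 R) * bool;
  gmul g h :=
    ((SL2Af_mul g.1.1 h.1.1, SL2_mul g.1.2 h.1.2),
     g.2 (+) h.2 (+) finite_cocycle g.1.1 h.1.1 (+) real_cocycle g.1.2 h.1.2);
  adjoin gf gi := ((gf.1, gi.1), gf.2 (+) gi.2);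
  proj_fin gf := gf.1;
  proj_inf gi := gi.1;
  lift_fin gf := (gf, false);
  lift_inf gi := (gi, false);
  jhalf gi z := (-1) ^+ gi.2 * principal_j gi.1 z |}.

Variant adelic_kind := Linear | Metaplectic.

Definition adelic_SL2 (R : realType) (t : adelic_kind) : adelic_group R :=
  match t with Linear => linear_SL2 R | Metaplectic => metaplectic_SL2 R end.

Section Automorphic.
Variables (R : realType) (G : adelic_group R).

Definition embed_fin (gf : Gfin G) : Gad G := adjoin gf (lift_inf G (SL2_one R)).
Definition embed_inf (gi : Ginf G) : Gad G := adjoin (lift_fin G SL2Af_one) gi.

(* inverse image of SL_2(Zhat) *)
Definition Ktilde : set (Gfin G) := [set k | SL2_Zhat (proj_fin k)].

Definition Kinf : set (Ginf G) :=
  [set k | (proj_inf k : 'M[R]_2) *m (proj_inf k : 'M[R]_2)^T = 1%:M].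

(* SL_2(Q) is perfect, so that such an s is unique; it is the diagonal embedding in
   the linear case. *)
Definition rational_splitting (s : SL2 rat -> Gad G) : Prop :=
  (forall c d, s (SL2_mul c d) = gmul (s c) (s d)) /\
  (forall c, exists gf gi, [/\ s c = adjoin gf gi, proj_fin gf = SL2Af_of_Q c &
                               proj_inf gi = SL2_map (@ratr R) c]).

Definition iter_partial (w : seq 'I_3) (f : 'rV[R]_3 -> R) : 'rV[R]_3 -> R :=
  foldr (fun j h x => 'D_(delta_mx 0 j) h x) f w.

Definition smooth3 (f : 'rV[R]_3 -> R) : Prop :=
  forall w : seq 'I_3, continuous (iter_partial w f) /\
    forall (x : 'rV[R]_3) (j : 'I_3), derivable (iter_partial w f) x (delta_mx 0 j).

(* (x, y, z) |-> n(x) a(y) n^-(z) is a chart of SL_2(R) around the identity, and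
   lift_inf is continuous along it since the lower right entry is positive. *)
Definition big_cell (v : 'rV[R]_3) : Gad G :=
  embed_inf (lift_inf G
    (SL2_mul (SL2_mul (upper (v 0 0)) (torus (v 0 1))) (lower (v 0 ord_max)))).

Definition smooth_inf (phi : Gad G -> R[i]) : Prop :=
  forall g, smooth3 (fun v => complex.Re (phi (gmul g (big_cell v)))) /\
            smooth3 (fun v => complex.Im (phi (gmul g (big_cell v)))).

Definition K_finite (phi : Gad G -> R[i]) : Prop :=
  exists (n : nat) (psi : 'I_n -> Gad G -> R[i]), forall k, Kinf k ->
    exists c : 'I_n -> R[i], forall g,
      phi (gmul g (embed_inf k)) = \sum_(i < n) c i * psi i g.

(* right derivative of phi along the one-parameter subgroup x *)
Definition lie_derive (x : R -> SL2 R) (phi : Gad G -> R[i]) : Gad G -> R[i] :=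
  fun g =>
    let f t := phi (gmul g (embed_inf (lift_inf G (x t)))) in
    derive1 (fun t => complex.Re (f t)) 0 +i* derive1 (fun t => complex.Im (f t)) 0.

(* H^2 + 2EF + 2FE, which generates the centre of the enveloping algebra of sl_2 *)
Definition casimir (phi : Gad G -> R[i]) : Gad G -> R[i] := fun g =>
  lie_derive (@torus R) (lie_derive (@torus R) phi) g
  + 2%:R * lie_derive (@upper R) (lie_derive (@lower R) phi) g
  + 2%:R * lie_derive (@lower R) (lie_derive (@upper R) phi) g.

Definition Z_finite (phi : Gad G -> R[i]) : Prop :=
  exists2 P : {poly R[i]}, P != 0 &
    forall g, \sum_(i < size P) P`_i * iter i casimir phi g = 0.

Definition moderate_growth (phi : Gad G -> R[i]) : Prop :=
  forall gf, exists (C : R) (n : nat), forall gi,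
    `|phi (adjoin gf gi)| <=
      (C * (\tr ((proj_inf gi : 'M[R]_2) *m (proj_inf gi : 'M[R]_2)^T)) ^+ n)%:C.

(* The open subgroups of the metaplectic group over A_f are those containing
   lift_fin (congruence_subgroup N) for some N divisible by 4: for such N the
   cocycle is trivial on congruence_subgroup N. *)
Definition automorphic_form (phi : Gad G -> R[i]) : Prop :=
  [/\ exists2 s, rational_splitting s & forall c g, phi (gmul (s c) g) = phi g,
      exists2 N : nat, (0 < N)%N & forall u, congruence_subgroup (4 * N) u ->
        forall g, phi (gmul g (embed_fin (lift_fin G u))) = phi g,
      smooth_inf phi,
      K_finite phi &
      Z_finite phi /\ moderate_growth phi].

(* The constant term of phi along the upper unipotent subgroup is an integral over
   Q \ A, for which [0, T) x T Zhat is a fundamental domain; for T as below, only the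
   integral over [0, T) remains. *)
Definition cuspidal (phi : Gad G -> R[i]) : Prop :=
  forall (g : Gad G) (T : nat), (0 < T)%N ->
    let n_inf x := embed_inf (lift_inf G (upper x)) in
    (forall u, congruence_subgroup T u ->
       (forall p, [/\ u p 0 0 = 1, u p 1 0 = 0 & u p 1 1 = 1]) ->
       forall x, phi (gmul (embed_fin (lift_fin G u)) (gmul (n_inf x) g))
                 = phi (gmul (n_inf x) g)) ->
    \int[lebesgue_measure]_(x in `[0, T%:R]) complex.Re (phi (gmul (n_inf x) g)) = 0
    /\
    \int[lebesgue_measure]_(x in `[0, T%:R]) complex.Im (phi (gmul (n_inf x) g)) = 0.

(* k is twice the weight in the next three definitions. *)

Definition whittaker (k : int) (n : R) (gi : Ginf G) : R[i] :=
  jhalf gi 'i ^ (- k) *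
  cexp ((0 +i* (2%:R * pi * n)) * SL2_act (proj_inf gi) 'i).

(* unconditional summation over the positive rationals *)
Definition fourier_expansion (k : int) (phi : Gad G -> R[i])
    (b : rat -> Gfin G -> R[i]) : Prop :=
  forall gf gi,
    summability.partial_sum
      (fun d : rat => if 0 < d then b d gf * whittaker k (ratr d) gi else 0)
      @ summability.totally --> (phi (adjoin gf gi) : R[i]^o).

Definition normalized_coef (k : int) (b : rat -> Gfin G -> R[i]) (d : rat)
    (gf : Gfin G) : R[i] :=
  ((ratr d : R) `^ (- (k%:~R / 2%:R / 2%:R)))%:C * b d gf.

End Automorphic.

(* Main.v *)
(** The absolute value of [phi] does not see the metaplectic sign, so it is a function
    [Phi] on SL_2(A_f) x SL_2(R), left invariant under SL_2(Q) and right invariant under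
    some congruence subgroup.  Write y = Im (g i) and lam = k / 4.  By strong approximation
    and reduction theory every value of [Phi] is taken at a point whose finite part lies in
    SL_2(Zhat) and with y >= 3/5; there the terms of the Fourier expansion have absolute
    value |b_d| y^lam exp(-2 pi d y), and since SL_2(Zhat) meets finitely many cosets of the
    congruence subgroup, [Phi] is bounded.  Let S be its supremum.

    Isolating one frequency of x |-> phi (n(x) g) gives |b_d| y^lam exp(-2 pi d y) <= S for
    all y > 0.  For k < 0 let y tend to 0 to get b_d = 0.  For k >= 0, y = 1/d gives
    |beta_d| <= S exp(2 pi).  Using |beta_d| <= eps for d < R and this bound for d >= R in
    the expansion at y >= 3/5, the tail is at most M exp(- pi R) S times a constant, that is
    at most S / 2 for A large, because 2 pi (3/5) > pi.  Hence S <= O(eps M) + S / 2. *)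

Require Import Defs.
From mathcomp Require Import all_boot all_order all_algebra.
From mathcomp Require Import generic_quotient ring_quotient finmap.
From mathcomp Require Import all_classical all_reals all_analysis.
From mathcomp Require Import complex ring lra.
Import Order.TTheory GRing.Theory Num.Theory.
Import numFieldNormedType.Exports.
Import ComplexField.Normc.

Set Implicit Arguments.
Unset Strict Implicit.
Unset Printing Implicit Defensive.

Local Open Scope classical_set_scope.
Local Open Scope ring_scope.
Local Open Scope complex_scope.

(** * Approximation in Q_p *)

Lemma padic_ball1 (p : nat) : padic_ball p 0 1.
Proof. by exists 1, 1%N; rewrite coprimen1. Qed.

Section PadicApproximation.
Local Open Scope quotient_scope.
Variable p : prime_nat.
Implicit Types (x y : Qp p) (q r : rat) (n : nat).

Lemma Qp_of_seq_eq (u v : padic_seq p) :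
  padic_null (val p) (fun i => u i - v i) -> Qp_of_seq u = Qp_of_seq v.
Proof.
move=> nuv; apply/eqP.
rewrite /Qp_of_seq piE Quotient.equivE.
exact/asboolP.
Qed.

Definition padic_ideal n : set (Qp p) :=
  [set x | exists2 z, padic_int z & x = (val p ^ n)%:R * z].

Lemma padic_ideal0 x : padic_ideal 0 x <-> padic_int x.
Proof.
split=> [[z hz ->]|hx]; first by rewrite expn0 mul1r.
by exists x; rewrite // expn0 mul1r.
Qed.

Lemma padic_ideal_of_rat n q :
  padic_ball (val p) n q -> padic_ideal n (Qp_of_rat p q).
Proof.
move=> [a [s [s0 cs qE]]]; exists (Qp_of_rat p (a%:~R / s%:R)).
  apply: padic_int_of_rat; exists a, s; split => //.
  by rewrite divfK ?pnatr_eq0 -?lt0n // expn0 mul1r.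
rewrite -(rmorph_nat (Qp_of_rat p)) -rmorphM /= mulrA -qE mulfK //.
by rewrite pnatr_eq0 -lt0n.
Qed.

Lemma padic_idealD n x y :
  padic_ideal n x -> padic_ideal n y -> padic_ideal n (x + y).
Proof.
move=> [a ha ->] [b hb ->]; exists (a + b); first exact: padic_intD.
by rewrite mulrDr.
Qed.

Lemma padic_int_nat m : padic_int (m%:R : Qp p).
Proof.
rewrite -(rmorph_nat (Qp_of_rat p)); apply: padic_int_of_rat.
by exists m%:Z, 1%N; rewrite coprimen1 mulr1 expn0 mul1r.
Qed.

Lemma padic_ideal_0 n : padic_ideal n 0.
Proof. by exists 0; rewrite ?mulr0 //; exact: (padic_int_nat 0). Qed.

Lemma padic_ideal_nat m : padic_ideal 0 m%:R.
Proof. exact/padic_ideal0/padic_int_nat. Qed.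

Lemma padic_idealM m n x y :
  padic_ideal m x -> padic_ideal n y -> padic_ideal (m + n) (x * y).
Proof.
move=> [a ha ->] [b hb ->]; exists (a * b); first exact: padic_intM.
by rewrite expnD natrM mulrACA.
Qed.

Lemma padic_ideal_le m n x : (m <= n)%N -> padic_ideal n x -> padic_ideal m x.
Proof.
move=> mn [a ha ->]; exists ((val p ^ (n - m))%:R * a).
  by apply: padic_intM => //; exact: padic_int_nat.
by rewrite mulrA -natrM -expnD subnKC.
Qed.

Lemma Qp_natX_neq0 n : (val p ^ n)%:R != 0 :> Qp p.
Proof.
rewrite -(rmorph_nat (Qp_of_rat p)) fmorph_eq0 pnatr_eq0 -lt0n expn_gt0.
by rewrite (prime_gt0 (valP p)).
Qed.

Lemma padic_ideal_cancel m n x :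
  padic_ideal (m + n) ((val p ^ m)%:R * x) -> padic_ideal n x.
Proof.
move=> [z hz xE]; exists z => //; apply: (mulfI (Qp_natX_neq0 m)).
by rewrite xE expnD natrM mulrA.
Qed.

(** Density of Q: a far term [u k] of a Cauchy sequence representing x serves, since all later terms
    differ from it by elements of p^n Z_(p). *)
Lemma Qp_approx_rat n x : exists q, padic_ideal n (x - Qp_of_rat p q).
Proof.
rewrite -[x]reprK; set u := repr x.
have /asboolP cu := padic_seqP u; have [k hk] := cu n.
(* [v] represents (x - u k) / p^n. Its early terms are set to 0 because [padic_int] asks every term
   of the sequence to be integral. *)
exists (u k); pose v i := if (k <= i)%N then (u i - u k) / (val p ^ n)%:R else 0.
have pn0 : (val p ^ n)%:R != 0 :> rat.
  by rewrite pnatr_eq0 -lt0n expn_gt0 (prime_gt0 (valP p)).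
have cv : padic_cauchy (val p) v.
  move=> m; have [l hl] := cu (n + m)%N; exists (maxn k l) => i j.
  rewrite !geq_max /v => /andP[ki li] /andP[kj lj]; rewrite ki kj.
  apply: (@padic_ball_cancel _ n); first exact: prime_gt0 (valP p).
  by rewrite mulrBr ![_ * (_ / _)]mulrC !divfK // opprB addrA subrK; exact: hl.
pose w := PadicSeq (introT (asboolP _) cv : v \in padic_cauchyb p).
exists (Qp_of_seq w).
  exists w => // i; rewrite /= /v; case: ifP => ki; last exact: padic_ball0.
  have := hk _ _ ki (leqnn k) => -[a [s [s0 cs qE]]].
  exists a, s; split => //; rewrite mulrAC qE expn0 mul1r mulrAC divff //.
  by rewrite mul1r.
rewrite -(rmorph_nat (Qp_of_rat p)) /Qp_of_rat /Qp_of_seq.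
rewrite -(rmorphM (\pi_{ideal_quot @padic_nullb p})).
rewrite -(rmorphB (\pi_{ideal_quot @padic_nullb p})).
apply: Qp_of_seq_eq => m; exists k => i ki.
rewrite [X in padic_ball _ _ X](_ : _ = 0); first exact: padic_ball0.
rewrite -[LHS]/(u i - u k - (val p ^ n)%:R * v i) /v ki mulrC divfK //.
by rewrite subrr.
Qed.

Lemma Qp_bounded x : exists e, padic_ideal 0 ((val p ^ e)%:R * x).
Proof.
have [q hq] := Qp_approx_rat 0 x.
have [e he] := padic_ball_denom q (valP p).
exists e; rewrite -[x](subrK (Qp_of_rat p q)) mulrDr; apply: padic_idealD.
  case: hq => z hz ->; apply: padic_ideal_le (leq0n e) _.
  by exists z; rewrite // expn0 mul1r.
by rewrite -(rmorph_nat (Qp_of_rat p)) -rmorphM; exact: padic_ideal_of_rat.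
Qed.

Lemma coprime_inv_mod (m s : nat) : (0 < s)%N -> coprime m s ->
  exists (t : nat) (c : int), (t%:Z * s%:Z = 1 + c * m%:Z)%R.
Proof.
move=> s0 cs; have [t c tE _] := egcdnP m s0.
exists t, c%:Z; rewrite -!PoszM -[1]/(1%N%:Z) -PoszD; congr Posz.
by rewrite tE addnC gcdnC; move: cs; rewrite /coprime => /eqP ->.
Qed.

(** Write q = a / (p^e s) with s prime to p, and t s = 1 + c p^(n+e). Then r = a t / p^e has only p
    in its denominator, and q - r = - a c p^n / s. *)
Lemma rat_approx_away n q : exists2 r,
  forall l : prime_nat, l != p -> padic_ball (val l) 0 r &
  padic_ball (val p) n (q - r).
Proof.
have p0 := prime_gt0 (valP p).
have [e [a [s [s0 cs]]]] := padic_ball_denom q (valP p).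
rewrite expn0 mul1r => qE.
have pX0 m : (val p ^ m)%:R != 0 :> rat by rewrite pnatr_eq0 -lt0n expn_gt0 p0.
have cs' : coprime (val p ^ (n + e)) s by rewrite coprimeXl.
have [t [c tE]] := coprime_inv_mod s0 cs'.
have tE' : t%:R * s%:R = 1 + c%:~R * ((val p ^ n)%:R * (val p ^ e)%:R) :> rat.
  have := congr1 (fun z : int => z%:~R : rat) tE.
  by rewrite !(rmorphM, rmorphD, rmorph1) /= -!pmulrn expnD natrM.
exists ((a * t%:Z)%:~R / (val p ^ e)%:R).
  move=> l lp; exists (a * t%:Z), (val p ^ e)%N; split.
  - by rewrite expn_gt0 p0.
  - rewrite coprimeXr // prime_coprime ?(valP l) // dvdn_prime2 ?(valP l) ?(valP p)//.
  - by rewrite divfK // expn0 mul1r.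
exists (- (a * c)), s; split => //; rewrite mulrBl rmorphN !rmorphM /= -!pmulrn.
apply: (mulfI (pX0 e)).
have -> : (val p ^ e)%:R * (q * s%:R - a%:~R * t%:R / (val p ^ e)%:R * s%:R) =
  (val p ^ e)%:R * q * s%:R - a%:~R * (t%:R * s%:R) * ((val p ^ e)%:R / (val p ^ e)%:R).
  by ring.
by rewrite divff // qE tE'; ring.
Qed.

Lemma Qp_approx_away n x : exists2 r,
  forall l : prime_nat, l != p -> padic_ball (val l) 0 r &
  padic_ideal n (x - Qp_of_rat p r).
Proof.
have [q hq] := Qp_approx_rat n x; have [r hr hqr] := rat_approx_away n q.
exists r => //; rewrite -(subrK (Qp_of_rat p q) x) -addrA; apply: padic_idealD => //.
by rewrite -rmorphB; exact: padic_ideal_of_rat.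
Qed.

End PadicApproximation.

(** * Strong approximation for SL_2 *)

Lemma ord2_cases (i : 'I_2) : i = 0 \/ i = 1.
Proof. by case: i => [[|[|//]] ?]; [left|right]; exact: val_inj. Qed.

Section Matrices2.
Variable A : comNzRingType.

Lemma mx2_eta (g : 'M[A]_2) : g = mx2 (g 0 0) (g 0 1) (g 1 0) (g 1 1).
Proof.
apply/matrixP => i j; rewrite mxE.
by case: (ord2_cases i) => ->; case: (ord2_cases j) => ->.
Qed.

Lemma mx2_mul (a b c d a' b' c' d' : A) :
  mx2 a b c d *m mx2 a' b' c' d' =
  mx2 (a * a' + b * c') (a * b' + b * d') (c * a' + d * c') (c * b' + d * d').
Proof.
apply/matrixP => i j; rewrite !mxE big_ord_recl big_ord1 !mxE /=.
by case: (ord2_cases i) => ->; case: (ord2_cases j) => ->.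
Qed.

Lemma mx2_1 : 1%:M = mx2 1 0 0 1 :> 'M[A]_2.
Proof. by rewrite [LHS]mx2_eta !mxE. Qed.

Lemma SL2_det_entries (g : SL2 A) : g 0 0 * g 1 1 - g 0 1 * g 1 0 = 1.
Proof. by rewrite -det_mx2 -mx2_eta SL2_det. Qed.

Lemma unip_up_subproof (x : A) : \det (mx2 1 x 0 1) == 1.
Proof. by rewrite det_mx2 mulr1 mulr0 subr0. Qed.
Lemma unip_low_subproof (x : A) : \det (mx2 1 0 x 1) == 1.
Proof. by rewrite det_mx2 mulr1 mul0r subr0. Qed.
Lemma SL2_inv_subproof (g : SL2 A) :
  \det (mx2 (g 1 1) (- g 0 1) (- g 1 0) (g 0 0)) == 1.
Proof. by rewrite det_mx2 mulrNN mulrC SL2_det_entries. Qed.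

Definition unip_up (x : A) : SL2 A := exist _ (mx2 1 x 0 1) (unip_up_subproof x).
Definition unip_low (x : A) : SL2 A := exist _ (mx2 1 0 x 1) (unip_low_subproof x).
Definition SL2_inv (g : SL2 A) : SL2 A :=
  exist _ (mx2 (g 1 1) (- g 0 1) (- g 1 0) (g 0 0)) (SL2_inv_subproof g).

Lemma SL2_mulV (g : SL2 A) : g *m SL2_inv g = 1%:M.
Proof.
rewrite /= {1}(mx2_eta g) mx2_mul mx2_1; have := SL2_det_entries g.
move: (g 0 0) (g 0 1) (g 1 0) (g 1 1) => a b c d gE.
by congr mx2; [rewrite -gE| | |rewrite -gE]; ring.
Qed.

Lemma SL2_mulA (g h l : SL2 A) : SL2_mul g (SL2_mul h l) = SL2_mul (SL2_mul g h) l.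
Proof. by apply: val_inj; rewrite /= mulmxA. Qed.

End Matrices2.

Lemma map_mx2 (A B : comNzRingType) (f : A -> B) a b c d :
  map_mx f (mx2 a b c d) = mx2 (f a) (f b) (f c) (f d).
Proof. by rewrite [LHS]mx2_eta !mxE. Qed.

Lemma SL2_map_one_mul (A B : comNzRingType) (f : {rmorphism A -> B}) (g : SL2 B) :
  SL2_mul (SL2_map f (SL2_one A)) g = g.
Proof. by apply: val_inj; rewrite /= map_mx1 mul1mx. Qed.

Lemma SL2_mapM (A B : comNzRingType) (f : {rmorphism A -> B}) (g h : SL2 A) :
  SL2_map f (SL2_mul g h) = SL2_mul (SL2_map f g) (SL2_map f h).
Proof. by apply: val_inj; rewrite /= map_mxM. Qed.

(** * Generation of SL_2 over a field by elementary matrices *)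

Section ElementaryGeneration.
Variable F : fieldType.

(** If the lower left entry c is nonzero, g is a product upper, lower, upper of unipotents with
    parameters (a - 1) / c, c and (d - 1) / c. If c = 0, multiplying by a lower unipotent first puts
    the nonzero a in its place. *)
Lemma SL2_elementary_ind (P : SL2 F -> Prop) :
  (forall x, P (unip_up x)) -> (forall x, P (unip_low x)) ->
  (forall g h, P g -> P h -> P (SL2_mul g h)) -> forall g, P g.
Proof.
move=> Pu Pl PM; have main (g : SL2 F) : g 1 0 != 0 -> P g.
  move=> c0; have gE := SL2_det_entries g.
  have -> : g = SL2_mul (SL2_mul (unip_up ((g 0 0 - 1) / g 1 0)) (unip_low (g 1 0)))
                        (unip_up ((g 1 1 - 1) / g 1 0)).
    apply: val_inj; rewrite /= !mx2_mul [LHS]mx2_eta.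
    move: (g 0 0) (g 0 1) (g 1 0) (g 1 1) c0 gE => a b c d c0 gE.
    have bE : b = (a * d - 1) / c by apply: (mulIf c0); rewrite divfK // -gE; ring.
    by rewrite bE; congr mx2; field.
  by apply: (PM _ _ (PM _ _ _ _)).
move=> g; have [c0|] := eqVneq (g 1 0) 0; last exact: main.
have -> : g = SL2_mul (unip_low (-1)) (SL2_mul (unip_low 1) g).
  apply: val_inj; rewrite /= (mx2_eta g) !mx2_mul [LHS](mx2_eta g).
  by rewrite ?mx2_mul; congr mx2; ring.
apply: PM => //; apply: main; rewrite /= (mx2_eta g) mx2_mul mxE /= c0.
rewrite mulr0 addr0 mul1r; apply/eqP => a0; have := SL2_det_entries g.
by rewrite a0 c0 mul0r mulr0 subr0 => /esym/eqP; rewrite oner_eq0.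
Qed.

End ElementaryGeneration.

Section StrongApproximation.

Definition away_integral (p : prime_nat) (gamma : SL2 rat) : Prop :=
  forall l : prime_nat, l != p -> forall i j, padic_ball (val l) 0 (gamma i j).

Definition mx_padic_ideal (p : prime_nat) n (g : 'M[Qp p]_2) : Prop :=
  forall i j, padic_ideal n (g i j).

(** The rational matrix approximates the inverse of g, since it acts from the left; being integral
    away from p, it preserves integrality at the other primes. *)
Definition SL2_approximable (p : prime_nat) (g : SL2 (Qp p)) : Prop :=
  forall n, exists2 gamma : SL2 rat, away_integral p gamma &
    mx_padic_ideal n (map_mx (Qp_of_rat p) gamma *m g - 1%:M).

Lemma mx_padic_idealD p n (g h : 'M[Qp p]_2) :
  mx_padic_ideal n g -> mx_padic_ideal n h -> mx_padic_ideal n (g + h).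
Proof. by move=> hg hh i j; rewrite mxE; exact: padic_idealD. Qed.

Lemma mx_padic_idealM p m n (g h : 'M[Qp p]_2) :
  mx_padic_ideal m g -> mx_padic_ideal n h -> mx_padic_ideal (m + n) (g *m h).
Proof.
move=> hg hh i j; rewrite mxE big_ord_recl big_ord1.
by apply: padic_idealD; exact: padic_idealM.
Qed.

Lemma mx_padic_bounded p (g : 'M[Qp p]_2) :
  exists e, mx_padic_ideal 0 ((val p ^ e)%:R *: g).
Proof.
have /choice[e he] : forall ij : 'I_2 * 'I_2, exists e,
    padic_ideal 0 ((val p ^ e)%:R * g ij.1 ij.2) by move=> ij; exact: Qp_bounded.
exists (\max_ij e ij)%N => i j; rewrite mxE.
have le_e := leq_bigmax (F := e) (i, j).
rewrite -(subnK le_e) expnD natrM -mulrA.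
apply: padic_ideal_le (leq0n (\max_ij e ij - e (i, j))) _.
have /padic_ideal0 hz := he (i, j).
by exists ((val p ^ e (i, j))%:R * g i j).
Qed.

Lemma away_integralM p gamma delta : away_integral p gamma ->
  away_integral p delta -> away_integral p (SL2_mul gamma delta).
Proof.
move=> hg hd l lp i j; rewrite /= mxE big_ord_recl big_ord1.
by apply: padic_ballD; apply: (@padic_ballM _ 0 0); [exact: hg|exact: hd|exact: hg|exact: hd].
Qed.

(** From D C g h - 1 = D (C g - 1) h + (D h - 1): D is chosen first, then C is taken finer by e + f
    powers of p to absorb the denominators of D and h. *)
Lemma SL2_approximable_mul p (g h : SL2 (Qp p)) :
  SL2_approximable g -> SL2_approximable h -> SL2_approximable (SL2_mul g h).
Proof.
move=> ag ah n; have [d ad hd] := ah n.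
have [e he] := mx_padic_bounded (map_mx (Qp_of_rat p) d).
have [f hf] := mx_padic_bounded h.
have [c ac hc] := ag ((e + f) + n)%N.
exists (SL2_mul d c); first exact: away_integralM.
rewrite /= map_mxM.
set D := map_mx _ d in hd he *; set C := map_mx _ c in hc *.
have -> : D *m C *m (g *m h) - 1%:M = D *m (C *m g - 1%:M) *m h + (D *m h - 1%:M).
  by rewrite mulmxBr mulmx1 mulmxBl !mulmxA addrA subrK.
apply: mx_padic_idealD; last exact: hd.
move=> i j.
apply: (@padic_ideal_cancel p (e + f)).
have := mx_padic_idealM (mx_padic_idealM he hc) hf.
rewrite -scalemxAr -!scalemxAl scalerA add0n addn0 => /(_ i j).
by rewrite mxE -natrM -expnD [(f + e)%N]addnC.
Qed.

Lemma Qp_SL2_approximable p (g : SL2 (Qp p)) : SL2_approximable g.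
Proof.
elim/SL2_elementary_ind: g => [x|x|]; last exact: SL2_approximable_mul.
  move=> n; have [r ar hr] := Qp_approx_away n x.
  exists (unip_up (- r)).
    move=> l lp i j; rewrite /= mxE.
    have b0 := padic_ball0 (val l) 0; have b1 := padic_ball1 (val l).
    by case: ifP; case: ifP => // _ _; exact/padic_ballN/ar.
  move=> i j; rewrite /= map_mx2 mx2_mul mx2_1 !mxE.
  rewrite rmorph0 rmorph1 rmorphN !(mulr0, mulr1, mul0r, mul1r, add0r, addr0).
  by case: ifP; case: ifP => _ _; rewrite ?subrr ?subr0 //; exact: padic_ideal_0.
move=> n; have [r ar hr] := Qp_approx_away n x.
exists (unip_low (- r)).
  move=> l lp i j; rewrite /= mxE.
  have b0 := padic_ball0 (val l) 0; have b1 := padic_ball1 (val l).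
  by case: ifP; case: ifP => // _ _; exact/padic_ballN/ar.
move=> i j; rewrite /= map_mx2 mx2_mul mx2_1 !mxE.
rewrite rmorph0 rmorph1 rmorphN !(mulr0, mulr1, mul0r, mul1r, add0r, addr0).
case: ifP; case: ifP => _ _; rewrite ?subrr ?subr0 1?[- _ + _]addrC //.
all: exact: padic_ideal_0.
Qed.

Lemma SL2_Zp_mul p (g h : SL2 (Qp p)) : SL2_Zp g -> SL2_Zp h -> SL2_Zp (SL2_mul g h).
Proof.
move=> hg hh i j; rewrite /= mxE big_ord_recl big_ord1.
by apply: padic_intD; apply: padic_intM; [exact: hg|exact: hh|exact: hg|exact: hh].
Qed.

(** Induction on the list of possibly bad primes: approximation at level 0 makes the component at p
    integral without spoiling the primes that were already good. *)
Lemma SL2_strong_approx_seq (s : seq prime_nat) (g : forall p, SL2 (Qp p)) :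
  (forall p, p \notin s -> SL2_Zp (g p)) ->
  exists gamma : SL2 rat, forall p, SL2_Zp (SL2_mul (SL2_map (Qp_of_rat p) gamma) (g p)).
Proof.
elim: s g => [|p s IH] g hg.
  by exists (SL2_one _) => p; rewrite SL2_map_one_mul; exact: hg.
have [c ac hc] := Qp_SL2_approximable (g p) 0.
have [q /=|d hd] := IH (fun q => SL2_mul (SL2_map (Qp_of_rat q) c) (g q)).
  have [->{q} _|qp qs] := eqVneq q p.
    move=> i j; apply/padic_ideal0; rewrite /= -[_ *m _](subrK 1%:M).
    by apply: mx_padic_idealD => // {}i {}j; rewrite mxE; exact: padic_ideal_nat.
  apply: SL2_Zp_mul; last by apply: hg; rewrite inE negb_or qp.
  by move=> i j; rewrite /= mxE; apply: padic_int_of_rat; exact: ac.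
by exists (SL2_mul d c) => q; rewrite SL2_mapM -SL2_mulA.
Qed.

Lemma SL2_strong_approx (g : SL2Af) :
  exists gamma : SL2 rat, SL2_Zhat (SL2Af_mul (SL2Af_of_Q gamma) g).
Proof.
have /finite_seqP[s sE] := SL2Af_restricted g.
apply: (@SL2_strong_approx_seq s) => p ps; apply: contrapT => np.
have : [set` s] p by rewrite -sE.
by rewrite /= (negPf ps).
Qed.

End StrongApproximation.

(** * Cosets of congruence subgroups in SL_2(Zhat) *)

Section PadicResidues.
Local Open Scope quotient_scope.
Variable p : prime_nat.
Implicit Types (x y : Qp p).

Lemma padic_ball_of_int q : padic_int (Qp_of_rat p q) -> padic_ball (val p) 0 q.
Proof.
move=> [u hu /eqP]; rewrite /Qp_of_rat /Qp_of_seq piE Quotient.equivE.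
move=> /asboolP/(_ 0%N)[k /(_ k (leqnn k)) hk].
by rewrite -[q](subrK (u k)); apply: padic_ballD.
Qed.

Lemma padic_intN x : padic_int x -> padic_int (- x).
Proof.
move=> hx; rewrite -mulN1r; apply: padic_intM => //.
rewrite -(rmorph1 (Qp_of_rat p)) -rmorphN; apply: padic_int_of_rat.
exact/padic_ballN/padic_ball1.
Qed.

Lemma padic_int_natV s : (0 < s)%N -> coprime (val p) s -> padic_int (s%:R^-1 : Qp p).
Proof.
move=> s0 cs; rewrite -(rmorph_nat (Qp_of_rat p)) -fmorphV; apply: padic_int_of_rat.
by exists 1, s; split=> //; rewrite mulVf ?pnatr_eq0 -?lt0n // expn0 mul1r.
Qed.

(** N is p^(v_p(N)) times a unit of Z_p, so a congruence modulo this power of p is a congruence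
    modulo N. *)
Lemma padic_ideal_logn N x : (0 < N)%N -> padic_ideal (logn (val p) N) x ->
  exists2 z, padic_int z & x = N%:R * z.
Proof.
move=> N0 [z hz ->]; have [s cs NE] := pfactor_coprime (valP p) N0.
have s0 : (0 < s)%N by move: N0; rewrite NE muln_gt0 => /andP[].
have s0' : s%:R != 0 :> Qp p.
  by rewrite -(rmorph_nat (Qp_of_rat p)) fmorph_eq0 pnatr_eq0 -lt0n.
exists (s%:R^-1 * z); first by apply: padic_intM => //; exact: padic_int_natV.
by rewrite [in RHS]NE natrM mulrACA mulfV // mul1r.
Qed.

Lemma padic_int_residue N x : (0 < N)%N -> padic_int x ->
  exists a : 'I_N, exists2 z, padic_int z & x - a%:R = N%:R * z.
Proof.
move=> N0 hx; set n := logn (val p) N.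
have [q hq] := Qp_approx_rat n x.
have [|a [s [s0 cs]]] := @padic_ball_of_int q.
  have /padic_ideal0 hq0 := padic_ideal_le (leq0n n) hq.
  by rewrite -[Qp_of_rat p q](subKr x); apply: padic_intD => //; exact: padic_intN.
rewrite expn0 mul1r => qE.
have [t [c tE]] := coprime_inv_mod s0 (coprimeXl n cs).
have tE' : t%:R * s%:R = 1 + c%:~R * (val p ^ n)%:R :> rat.
  have := congr1 (fun z : int => z%:~R : rat) tE.
  by rewrite !(rmorphM, rmorphD, rmorph1) /= -!pmulrn.
(* The approximation a / s is replaced by the integer a t, where t inverts s modulo p^n; this
   integer is then reduced modulo N. *)
pose A := a * t%:Z; have NZ0 : N%:Z != 0 by rewrite eqz_nat -lt0n.
have r0 : (0 <= (A %% N%:Z)%Z)%R by rewrite modz_ge0.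
have rN : (`|(A %% N%:Z)%Z|%N < N)%N.
  by rewrite -ltz_nat gez0_abs // ltz_pmod // ltz_nat.
exists (Ordinal rN).
have [w hw wE] : exists2 z, padic_int z & x - A%:~R = N%:R * z.
  apply: padic_ideal_logn => //; rewrite -/n -(subrK (Qp_of_rat p q) x) -addrA.
  apply: padic_idealD => //; rewrite -(rmorph_int (Qp_of_rat p)) -rmorphB.
  apply: padic_ideal_of_rat; exists (- (a * c)), s; split=> //.
  rewrite mulrBl qE /A rmorphN !rmorphM /= -!pmulrn -mulrA tE'; ring.
exists (w + (A %/ N%:Z)%Z%:~R).
  apply: padic_intD => //; rewrite -(rmorph_int (Qp_of_rat p)).
  by apply: padic_int_of_rat; exists (A %/ N%:Z)%Z, 1%N; rewrite coprimen1 mulr1 expn0 mul1r.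
have := congr1 (fun z : int => z%:~R : Qp p) (divz_eq A N%:Z).
rewrite rmorphD rmorphM /= -pmulrn => AE.
by rewrite mulrDr -wE /= pmulrn gez0_abs // AE; ring.
Qed.

End PadicResidues.

Section CongruenceCosets.

Lemma SL2Af_eq (g h : SL2Af) : (forall p, g p = h p) -> g = h.
Proof.
case: g h => [g hg] [h hh] /= gh.
have E : g = h by apply: functional_extensionality_dep.
by subst h; congr MkSL2Af; exact: Prop_irrelevance.
Qed.

Lemma SL2_Zp_inv p (g : SL2 (Qp p)) : SL2_Zp g -> SL2_Zp (SL2_inv g).
Proof.
move=> hg i j; rewrite /= mxE.
by case: ifP; case: ifP => _ _; (try apply: padic_intN); exact: hg.
Qed.

Lemma SL2_Zp_restricted (g : forall p, SL2 (Qp p)) : (forall p, SL2_Zp (g p)) ->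
  finite_set [set p | ~ SL2_Zp (g p)].
Proof.
by move=> hg; rewrite (_ : [set _ | _] = set0) //; apply/seteqP; split=> // p /=; apply.
Qed.

(** Take u = k^-1 k'; then u - 1 = k^-1 (k' - k) is an integral matrix times a multiple of N. *)
Lemma congruence_quotient N (k k' : SL2Af) : (0 < N)%N ->
  SL2_Zhat k -> SL2_Zhat k' ->
  (forall p i j, exists2 z : Qp p, padic_int z & k' p i j - k p i j = N%:R * z) ->
  exists2 u, congruence_subgroup N u & k' = SL2Af_mul k u.
Proof.
move=> N0 hk hk' kk'.
have hu p : SL2_Zp (SL2_mul (SL2_inv (k p)) (k' p)).
  by apply: SL2_Zp_mul => //; exact: SL2_Zp_inv.
exists (MkSL2Af (SL2_Zp_restricted hu)) => [p i j /=|]; last first.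
  by apply: SL2Af_eq => p; apply: val_inj; rewrite /= mulmxA SL2_mulV mul1mx.
have -> : (i == j)%:R = (SL2_inv (k p) *m k p) i j :> Qp p.
  by rewrite (mulmx1C (SL2_mulV (k p))) mxE.
rewrite -[mx2 _ _ _ _]/(SL2_mx (SL2_inv (k p))).
have -> : (SL2_inv (k p) *m k' p) i j - (SL2_inv (k p) *m k p) i j =
    (SL2_inv (k p) *m (SL2_mx (k' p) - SL2_mx (k p))) i j by rewrite mulmxBr !mxE.
have : forall i j, padic_int (SL2_inv (k p) i j) by exact: SL2_Zp_inv.
move: (SL2_mx (SL2_inv (k p))) => X hX; rewrite mxE big_ord_recl big_ord1 !mxE.
have [z hz ->] := kk' p 0 j.
have [w hw ->] := kk' p (lift 0 0) j.
exists (X i 0 * z + X i (lift 0 0) * w); first by apply: padic_intD; exact: padic_intM.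
by ring.
Qed.

(** A coset is recorded by the residues modulo N of the entries at the primes p <= N. For p > N the
    integer N is a unit of Z_p and the congruence is automatic. *)
Lemma congruence_finite_index N : (0 < N)%N ->
  exists (T : finType) (f : SL2Af -> T), forall k k', SL2_Zhat k -> SL2_Zhat k' ->
    f k = f k' -> exists2 u, congruence_subgroup N u & k' = SL2Af_mul k u.
Proof.
move=> N0.
have /choice[res hres] : forall px : {p : prime_nat & Qp p}, exists a : 'I_N,
    padic_int (projT2 px) ->
    exists2 z, padic_int z & projT2 px - a%:R = N%:R * z.
  move=> [p x] /=; have [hx|nx] := pselect (padic_int x); last first.
    by exists (Ordinal N0).
  by have [a ha] := padic_int_residue N0 hx; exists a.
(* The index set 'I_N.+1 runs over all numbers up to N; those that are not prime receive a dummy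
   residue. *)
pose f (k : SL2Af) : {ffun 'I_N.+1 * ('I_2 * 'I_2) -> 'I_N} := [ffun m =>
  if insub (val m.1) is Some p then res (existT _ p (k p m.2.1 m.2.2))
  else Ordinal N0].
exists {ffun 'I_N.+1 * ('I_2 * 'I_2) -> 'I_N}, f => k k' hk hk' ff.
apply: congruence_quotient => // p i j.
have [pN|Np] := leqP (val p) N; last first.
  apply: padic_ideal_logn => //.
  rewrite lognE (valP p) N0 gtnNdvd //=; apply/padic_ideal0.
  by apply: padic_intD; [exact: hk'|apply: padic_intN; exact: hk].
have /ffunP/(_ (Ordinal (pN : (val p < N.+1)%N), (i, j))) := ff.
rewrite !ffunE /= valK => rE.
have [z hz zE] := hres (existT _ p (k p i j)) (hk p i j).
have [w hw wE] := hres (existT _ p (k' p i j)) (hk' p i j).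
exists (w - z); first by apply: padic_intD => //; exact: padic_intN.
rewrite mulrBr -zE -wE /= rE; ring.
Qed.

End CongruenceCosets.

(** * Reduction theory for SL_2(Z) *)

Section Reduction.
Variable R : realType.

Definition SL2_integral (gamma : SL2 rat) : Prop :=
  forall i j, exists n : int, gamma i j = n%:~R.

Lemma SL2_integralM gamma delta : SL2_integral gamma -> SL2_integral delta ->
  SL2_integral (SL2_mul gamma delta).
Proof.
move=> hg hd i j; rewrite /= mxE big_ord_recl big_ord1.
have [a ->] := hg i 0; have [b ->] := hd 0 j.
have [c ->] := hg i (lift 0 0); have [d ->] := hd (lift 0 0) j.
by exists (a * b + c * d); rewrite rmorphD !rmorphM.
Qed.

Lemma SL2_integral_Zp gamma p : SL2_integral gamma ->
  SL2_Zp (SL2_map (Qp_of_rat p) gamma).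
Proof.
move=> hg i j; rewrite /= mxE; apply: padic_int_of_rat.
by have [n ->] := hg i j; exists n, 1%N; rewrite coprimen1 mulr1 expn0 mul1r.
Qed.

Lemma inversion_subproof (m : rat) : \det (mx2 0 (-1) 1 m) == 1.
Proof. by rewrite det_mx2 mul0r mulr1 opprK add0r. Qed.

(** This matrix acts as z -> -1 / (z + m). *)
Definition shift_inversion (m : int) : SL2 rat :=
  exist _ (mx2 0 (-1) 1 m%:~R) (inversion_subproof m%:~R).

(** This is |c i + d|^2, the inverse of the imaginary part of g i. *)
Definition bottom_norm (g : SL2 R) : R := g 1 0 ^+ 2 + g 1 1 ^+ 2.

Lemma bottom_norm_gt0 g : 0 < bottom_norm g.
Proof.
rewrite lt_neqAle addr_ge0 ?sqr_ge0 // andbT eq_sym paddr_eq0 ?sqr_ge0 //.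
rewrite !expf_eq0 /=; apply/negP => /andP[/eqP c0 /eqP d0].
have := SL2_det_entries g; rewrite c0 d0 !mulr0 subr0 => /esym/eqP.
by rewrite oner_eq0.
Qed.

Lemma round_shift (x D : R) : 0 < D -> exists m : int, `|x + m%:~R * D| <= D / 2.
Proof.
move=> D0; exists (- Num.floor (x / D + 1 / 2)).
set f := Num.floor _.
have /andP[f1 f2] := floor_itv (x / D + 1 / 2).
rewrite -/f in f1 f2.
have xE : x = x / D * D by rewrite divfK ?gt_eqF.
rewrite rmorphN /= {1}xE mulNr -mulrBl normrM (gtr0_norm D0) mulrC ler_pM2l //.
rewrite rmorphD /= in f2; rewrite ler_norml; apply/andP; split; lra.
Qed.

(* Shifting so that the real part of [g i] is at most 1/2 in modulus and then inverting
   multiplies the imaginary part 1 / bottom_norm g by at least 100 / 61 whenever it is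
   below 3 / 5. *)
Lemma reduction_step g : 5 / 3 < bottom_norm g -> exists m : int,
  bottom_norm (SL2_mul (SL2_map (@ratr R) (shift_inversion m)) g)
    <= 61 / 100 * bottom_norm g.
Proof.
move=> gD; set D := bottom_norm g.
have D0 : 0 < D := bottom_norm_gt0 g.
have [m hm] := round_shift (g 0 0 * g 1 0 + g 0 1 * g 1 1) D0; exists m.
rewrite /bottom_norm /= map_mx2 (mx2_eta g) mx2_mul !mxE /=.
rewrite rmorph1 ratr_int !mul1r; have gE := SL2_det_entries g.
rewrite -(ler_pM2r D0); move: hm gE gD; rewrite -/D /D /bottom_norm.
move: (g 0 0) (g 0 1) (g 1 0) (g 1 1) m%:~R => a b c d t hm gE gD.
set E := c ^+ 2 + d ^+ 2 in hm gD *.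
(* Lagrange's identity: as the determinant is 1, the new norm times E is 1 + x^2 with |x| <= E / 2.
   For E > 5/3 this is at most (9/25 + 1/4) E^2, whence 61/100. *)
have -> : ((a + t * c) ^+ 2 + (b + t * d) ^+ 2) * E =
    (a * d - b * c) ^+ 2 + (a * c + b * d + t * E) ^+ 2 by rewrite /E; ring.
rewrite gE; have : `|a * c + b * d + t * E| ^+ 2 <= (E / 2) ^+ 2.
  by rewrite lerXn2r // nnegrE //; lra.
by rewrite real_normK ?num_real //; nra.
Qed.

(** Each reduction step shrinks the norm geometrically while it exceeds 5/3; the exponent n bounds
    the number of steps left. *)
Lemma reduction_theory g : exists2 gamma, SL2_integral gamma &
  bottom_norm (SL2_mul (SL2_map (@ratr R) gamma) g) <= 5 / 3.
Proof.
have [n hn] : exists n, (61 / 100) ^+ n * bottom_norm g <= 5 / 3 :> R.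
  have : (61 / 100 : R) ^+ n @[n --> \oo] --> (0 : R).
    have q0 : (0 : R) <= 61 / 100 by lra.
    have q1 : `|(61 / 100 : R)| < 1 by rewrite (ger0_norm q0); lra.
    exact: cvg_expr q1.
  have e0 : 0 < 5 / 3 / bottom_norm g by rewrite !divr_gt0 ?bottom_norm_gt0.
  move=> /cvgrPdist_lt/(_ _ e0)[n _ /(_ n (leqnn n))] /=.
  have qn0 : 0 <= (61 / 100) ^+ n :> R by apply: exprn_ge0; lra.
  rewrite sub0r normrN (ger0_norm qn0).
  by rewrite ltr_pdivlMr ?bottom_norm_gt0 // => /ltW; exists n.
elim: n g hn => [|n IH] g hn; have [gD|gD] := leP (bottom_norm g) (5 / 3).
1,3: exists (SL2_one _); last by rewrite SL2_map_one_mul.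
1,2: by move=> i j; exists (i == j)%:Z; rewrite mxE pmulrn.
  by move: hn; rewrite expr0 mul1r leNgt gD.
have [m hm] := reduction_step gD.
have [|c ic hc] := IH (SL2_mul (SL2_map (@ratr R) (shift_inversion m)) g).
  by apply: le_trans hn; rewrite exprSr -mulrA ler_wpM2l // exprn_ge0 //; lra.
exists (SL2_mul c (shift_inversion m)); last by rewrite SL2_mapM -SL2_mulA.
apply: SL2_integralM => // i j; rewrite /= mxE.
by case: ifP; case: ifP => _ _; [exists 0|exists (-1)|exists 1|exists m].
Qed.

End Reduction.

(** * Unconditional sums and Fourier coefficients *)

Section ComplexNorm.
Variable R : realType.
Implicit Types z w : R[i].

Lemma normC_def z : `|z| = (normc z)%:C.
Proof. by []. Qed.

Lemma normc_ge0 z : 0 <= normc z.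
Proof. by rewrite -lecR -normC_def normr_ge0. Qed.

Lemma normcN z : normc (- z) = normc z.
Proof. by case: z => a b /=; rewrite !sqrrN. Qed.

Lemma ler_normcD z w : normc (z + w) <= normc z + normc w.
Proof. by rewrite -lecR rmorphD /= -!normC_def ler_normD. Qed.

Lemma ler_normc_sum I (s : seq I) (P : pred I) (F : I -> R[i]) :
  normc (\sum_(i <- s | P i) F i) <= \sum_(i <- s | P i) normc (F i).
Proof.
apply: (big_ind2 (fun z x => normc z <= x)) => //; first by rewrite normc0.
by move=> z x w y hz hw; apply: le_trans (ler_normcD _ _) _; exact: lerD.
Qed.

Lemma ler_Re_normc z : `|complex.Re z| <= normc z.
Proof.
case: z => a b /=; rewrite -sqrtr_sqr ler_sqrt ?lerDl ?sqr_ge0 //.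
by rewrite addr_ge0 ?sqr_ge0.
Qed.

Lemma ler_Im_normc z : `|complex.Im z| <= normc z.
Proof.
case: z => a b /=; rewrite -sqrtr_sqr ler_sqrt ?lerDr ?sqr_ge0 //.
by rewrite addr_ge0 ?sqr_ge0.
Qed.

Lemma normc_le_ReIm z : normc z <= `|complex.Re z| + `|complex.Im z|.
Proof.
case: z => a b /=.
rewrite -[leRHS]ger0_norm ?addr_ge0 // -sqrtr_sqr ler_sqrt ?sqr_ge0 //.
rewrite -(real_normK (num_real a)) -(real_normK (num_real b)).
by have := normr_ge0 a; have := normr_ge0 b; nra.
Qed.

Lemma normc_real (x : R) : normc x%:C = `|x|.
Proof. by rewrite /= expr0n /= addr0 sqrtr_sqr. Qed.

Lemma normcX z n : normc (z ^+ n) = normc z ^+ n.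
Proof. by elim: n => [|n IH]; rewrite ?expr0 ?normc1 // !exprS normcM IH. Qed.

Definition cis (x : R) : R[i] := cos x +i* sin x.

Lemma cis0 : cis 0 = 1.
Proof. by rewrite /cis cos0 sin0. Qed.

Lemma cispi : cis pi = -1.
Proof. by rewrite /cis cospi sinpi; apply/eqP; rewrite eq_complex /= oppr0 !eqxx. Qed.

Lemma cisD x y : cis (x + y) = cis x * cis y.
Proof. by rewrite /cis cosD sinD; apply/eqP; rewrite eq_complex /= eqxx; apply/eqP; ring. Qed.

Lemma normc_cis x : normc (cis x) = 1.
Proof. by rewrite /= cos2Dsin2 sqrtr1. Qed.

End ComplexNorm.

Section UnconditionalSums.
Variables (R : realType) (I : choiceType).
Implicit Types (a : I -> R[i]) (E J : {fset I}).

Definition unconditional_sum a (l : R[i]) : Prop :=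
  forall e : R, 0 < e -> exists E0 : {fset I}, forall E, (E0 `<=` E)%fset ->
    normc (l - \sum_(i <- E) a i) < e.

Lemma unconditional_sum_cvg a (l : R[i]) :
  summability.partial_sum a @ summability.totally --> (l : R[i]^o) ->
  unconditional_sum a l.
Proof.
move=> cvl e e0.
have FF := @summability.totally_filter I.
have e0' : 0 < e%:C by rewrite ltcR.
have [E0 _ hE0] := (cvgrPdist_lt (V := R[i]^o) (FF := FF) _ _).1 cvl _ e0'.
exists E0 => E /hE0 /=.
rewrite /summability.partial_sum -(big_seq_fsetE _ _ predT a) /=.
by rewrite normC_def ltcR.
Qed.

Lemma sum_fsetU_disjoint (V : nmodType) (f : I -> V) E J :
  {in J, forall i, i \notin E} ->
  \sum_(i <- (E `|` J)%fset) f i = \sum_(i <- E) f i + \sum_(i <- J) f i.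
Proof.
move=> dJ; rewrite (big_fsetID _ (mem E)) /=; congr (_ + _); apply: eq_fbigl => i.
  by rewrite !inE /=; case: (i \in E); rewrite ?andbT ?andbF.
rewrite !inE /=; case: (boolP (i \in J)) => [/dJ ->|_]; rewrite ?orbT //.
by rewrite orbF andbN.
Qed.

Lemma sum_fsetD (V : nmodType) (f : I -> V) E E0 :
  (E0 `<=` E)%fset ->
  \sum_(i <- E) f i = \sum_(i <- E0) f i + \sum_(i <- (E `\` E0)%fset) f i.
Proof.
move=> sE; rewrite -sum_fsetU_disjoint; last by move=> i; rewrite inE => /andP[].
by rewrite fsetUDl fsetDv fsetD0 (fsetUidPr _ _ sE).
Qed.

Lemma unconditional_sum_le a l E0 (B : R) : unconditional_sum a l ->
  (forall E, (E0 `<=` E)%fset -> normc (\sum_(i <- E) a i) <= B) -> normc l <= B.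
Proof.
move=> sl hB; apply/ler_addgt0Pr => e e0; have [E1 hE1] := sl _ e0.
have lt_e := hE1 _ (fsubsetUr E0 E1); have le_B := hB _ (fsubsetUl E0 E1).
rewrite -[l](subrK (\sum_(i <- (E0 `|` E1)%fset) a i)).
by apply: le_trans (ler_normcD _ _) _; rewrite addrC; apply: lerD => //; exact: ltW.
Qed.

Lemma unconditional_sum_cauchy a l : unconditional_sum a l ->
  forall e : R, 0 < e -> exists E0 : {fset I}, forall J, {in J, forall i, i \notin E0} ->
    normc (\sum_(i <- J) a i) <= e.
Proof.
move=> sl e e0; have e2 : 0 < e / 2 by rewrite divr_gt0.
have [E0 hE0] := sl _ e2; exists E0 => J dJ.
have h0 := hE0 _ (fsubset_refl _); have h1 := hE0 _ (fsubsetUl E0 J).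
have -> : \sum_(i <- J) a i = (l - \sum_(i <- E0) a i) - (l - \sum_(i <- (E0 `|` J)%fset) a i).
  by rewrite sum_fsetU_disjoint //; ring.
by apply: le_trans (ler_normcD _ _) _; rewrite normcN; lra.
Qed.

(** Unconditional convergence in the complex numbers is absolute: J is split by the sign of the real
    part and by that of the imaginary part, and each of the four subsums is at most e / 4 by the
    Cauchy property. *)
Lemma unconditional_sum_abs a l : unconditional_sum a l ->
  forall e : R, 0 < e -> exists E0 : {fset I}, forall J, {in J, forall i, i \notin E0} ->
    \sum_(i <- J) normc (a i) <= e.
Proof.
move=> sl e e0; have e4 : 0 < e / 4 by rewrite divr_gt0.
have [E0 hE0] := unconditional_sum_cauchy sl e4; exists E0 => J dJ.
have sub (P : pred I) : normc (\sum_(i <- J | P i) a i) <= e / 4.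
  rewrite big_fset_condE /=.
  by apply: hE0 => i; rewrite !inE /= => /andP[/dJ].
have part (f : {additive R[i] -> R}) : (forall z, `|f z| <= normc z) ->
    \sum_(i <- J) `|f (a i)| <= e / 2.
  move=> hf; rewrite (bigID (fun i => 0 <= f (a i))) /=.
  have -> : e / 2 = e / 4 + e / 4 by field.
  apply: lerD.
    rewrite (eq_bigr (fun i => f (a i))) => [|i /ger0_norm //].
    by rewrite -raddf_sum; apply: le_trans (sub _); apply: le_trans (hf _); exact: ler_norm.
  rewrite (eq_bigr (fun i => - f (a i))) => [|i]; last first.
    by rewrite -ltNge => /ltr0_norm.
  rewrite sumrN -raddf_sum; apply: le_trans (ler_norm _) _; rewrite normrN.
  exact: le_trans (hf _) (sub _).
apply: (@le_trans _ _ (\sum_(i <- J) (`|complex.Re (a i)| + `|complex.Im (a i)|))).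
  by apply: ler_sum => i _; exact: normc_le_ReIm.
rewrite big_split /= (splitr e); apply: lerD.
  exact: (part (@complex.Re R)) (@ler_Re_normc R).
exact: (part (@complex.Im R)) (@ler_Im_normc R).
Qed.

Lemma unconditional_sum_abs_bounded a l : unconditional_sum a l ->
  exists B : R, forall E, \sum_(i <- E) normc (a i) <= B.
Proof.
move=> sl; have [E0 hE0] := unconditional_sum_abs sl ltr01.
exists (\sum_(i <- E0) normc (a i) + 1) => E.
apply: (@le_trans _ _ (\sum_(i <- (E0 `|` E)%fset) normc (a i))).
  by rewrite (sum_fsetD _ (fsubsetUr E0 E)) lerDl sumr_ge0 // => i _; exact: normc_ge0.
rewrite (sum_fsetD _ (fsubsetUl E0 E)) lerD2l; apply: hE0 => i.
by rewrite inE => /andP[].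
Qed.

End UnconditionalSums.

(** * Coefficients of a bounded trigonometric series *)

Section CoefficientBound.
Variables (R : realType) (I : choiceType) (w : I -> R).
Hypothesis w_inj : injective w.

(* Replacing P by x |-> (P x + cis (- w_i0 th) P (x + th)) / 2 with
   th = pi / (w_j - w_i0) removes the frequency w_j, keeps the coefficient at w_i0 and
   does not increase the bound. *)
Lemma trig_poly_coef_le (s : seq I) (i0 : I) (c : I -> R[i]) (S : R) :
  i0 \notin s ->
  (forall x, normc (c i0 * cis (w i0 * x) + \sum_(i <- s) c i * cis (w i * x)) <= S) ->
  normc (c i0) <= S.
Proof.
elim: s c => [|j s IH] c.
  by move=> _ /(_ 0); rewrite big_nil mulr0 addr0 cis0 mulr1.
rewrite inE negb_or => /andP[ij is_] hS.
have wij : w j - w i0 != 0.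
  by rewrite subr_eq0; apply: contra ij => /eqP/w_inj ->.
pose th := pi / (w j - w i0).
(* The averaging multiplies the coefficient at i by this factor, which is 1 at i0 and 0 at j. *)
pose c' i := c i * ((1 + cis ((w i - w i0) * th)) / 2%:R).
have two0 : (2%:R : R[i]) != 0 by rewrite pnatr_eq0.
have c'0 : c' i0 = c i0.
  by rewrite /c' subrr mul0r cis0 -[1 + 1]/(2%:R) divff // mulr1.
rewrite -c'0; apply: IH => // x.
have c'j : c' j = 0 by rewrite /c' /th [(w j - w i0) * _]mulrC divfK // cispi subrr mul0r mulr0.
set P := fun x => c i0 * cis (w i0 * x) + \sum_(i <- j :: s) c i * cis (w i * x).
have -> : c' i0 * cis (w i0 * x) + \sum_(i <- s) c' i * cis (w i * x) =
    2%:R^-1 * (P x + cis (- (w i0 * th)) * P (x + th)).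
  have -> : \sum_(i <- s) c' i * cis (w i * x) = \sum_(i <- j :: s) c' i * cis (w i * x).
    by rewrite big_cons c'j mul0r add0r.
  rewrite /P.
  have E i : c' i * cis (w i * x) =
     2%:R^-1 * (c i * cis (w i * x) + cis (- (w i0 * th)) * (c i * cis (w i * (x + th)))).
    have -> : w i * (x + th) = w i * x + w i0 * th + (w i - w i0) * th by ring.
    rewrite !cisD /c'; have := cisD (- (w i0 * th)) (w i0 * th).
    rewrite addNr cis0 => K.
    set u := cis (- _) in K *; set v := cis (w i0 * th) in K *.
    have -> : u * (c i * (cis (w i * x) * v * cis ((w i - w i0) * th))) =
      (u * v) * (c i * (cis (w i * x) * cis ((w i - w i0) * th))) by ring.
    by rewrite -K; ring.
  rewrite E (eq_bigr _ (fun i _ => E i)) -mulr_sumr -mulrDr big_split /=.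
  by rewrite -mulr_sumr; ring.
rewrite normcM normcV -(rmorph_nat (real_complex R)) normc_real ger0_norm //.
have P1 := hS x; have P2 := hS (x + th); rewrite -/(P _) in P1 P2.
have := ler_normcD (P x) (cis (- (w i0 * th)) * P (x + th)).
rewrite normcM normc_cis mul1r => P3; rewrite mulrC ler_pdivrMr //; lra.
Qed.

(** The absolute values of the terms do not depend on x, so absolute convergence at x = 0 makes the
    tail small uniformly in x. The remaining trigonometric polynomial is then bounded by S + e
    everywhere. *)
Lemma unconditional_coef_le (c : I -> R[i]) (f : R -> R[i]) (S : R) (i0 : I) :
  (forall x, unconditional_sum (fun i => c i * cis (w i * x)) (f x)) ->
  (forall x, normc (f x) <= S) -> normc (c i0) <= S.
Proof.
move=> sf fS; apply/ler_addgt0Pr => e e0.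
have [E0 hE0] := unconditional_sum_abs (sf 0) e0.
pose E1 := (i0 |` E0)%fset.
apply: (@trig_poly_coef_le (E1 `\ i0)%fset) => [|x]; first by rewrite !inE eqxx.
rewrite -(big_fsetD1 i0 (F := fun i => c i * cis (w i * x))) ?fset1U1 //.
apply/ler_addgt0Pr => h h0; have [E hE] := sf x _ h0.
have lt_h := hE _ (fsubsetUr E1 E).
rewrite (sum_fsetD _ (fsubsetUl E1 E)) in lt_h.
set T := \sum_(i <- E1) _ in lt_h *; set J := (_ `\` E1)%fset in lt_h.
have hJ : normc (\sum_(i <- J) c i * cis (w i * x)) <= e.
  apply: le_trans (ler_normc_sum _ _ _) _.
  rewrite (eq_bigr (fun i => normc (c i * cis (w i * 0)))).
    apply: hE0 => i; rewrite !inE !negb_or => /andP[/andP[_ iE0] _] //.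
  by move=> i _; rewrite !normcM !normc_cis.
set U := \sum_(i <- J) _ in lt_h hJ.
have -> : T = f x - (f x - (T + U)) - U by ring.
apply: le_trans (ler_normcD _ _) _; rewrite normcN.
have := ler_normcD (f x) (- (f x - (T + U))); rewrite normcN.
by have := fS x; lra.
Qed.

End CoefficientBound.

(** * Whittaker functions *)

Section WhittakerNorm.
Variable R : realType.
Implicit Types (g : SL2 R) (x y : R).

Lemma cexp_scaled_i (t x y : R) :
  cexp ((0 +i* t) * (x +i* y)) = (expR (- (t * y)))%:C * cis (t * x).
Proof. by rewrite /cexp /cis /= !mul0r sub0r add0r. Qed.

Lemma real_linear_i (u v : R) : u%:C * 'i + v%:C = v +i* u.
Proof. by apply/eqP; rewrite eq_complex /=; apply/andP; split; apply/eqP; ring. Qed.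

Lemma SL2_act_i g : SL2_act g 'i =
  ((g 0 0 * g 1 0 + g 0 1 * g 1 1) / bottom_norm g) +i* (bottom_norm g)^-1.
Proof.
have D0 : bottom_norm g != 0 by rewrite gt_eqF // bottom_norm_gt0.
have gE := SL2_det_entries g.
rewrite /SL2_act; move: D0 gE; rewrite /bottom_norm.
move: (g 0 0) (g 0 1) (g 1 0) (g 1 1) => a b c d D0 gE.
have DC0 : d +i* c != 0.
  apply: contra D0; rewrite eq_complex /= => /andP[/eqP -> /eqP ->].
  by rewrite expr0n addr0.
rewrite !real_linear_i; apply: (mulIf DC0); rewrite divfK //.
apply/eqP; rewrite eq_complex /=; apply/andP; split; apply/eqP.
  apply: (mulIf D0); rewrite mulrBl mulrAC divfK // mulrAC mulVf // mul1r.
  rewrite -[X in _ = _ - X]mulr1 -gE; ring.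
apply: (mulIf D0); rewrite mulrDl mulrAC divfK // mulrAC mulVf // mul1r.
rewrite -[X in _ = _ + X]mulr1 -gE; ring.
Qed.

Lemma normc_principal_j g :
  normc (principal_j g 'i) = bottom_norm g `^ (4%:R^-1).
Proof.
have D0 := bottom_norm_gt0 g.
have : normc (principal_j g 'i) ^+ 2 = bottom_norm g `^ (2%:R^-1).
  rewrite -normcX sqr_sqrtc powR12_sqrt ?ltW // /bottom_norm real_linear_i /=.
  by rewrite addrC.
move=> /(congr1 Num.sqrt); rewrite sqrtr_sqr ger0_norm ?normc_ge0 // => ->.
rewrite -powR12_sqrt ?powR_ge0 // -powRrM; congr (_ `^ _).
by field.
Qed.

Lemma normcXz (z : R[i]) (k : int) : normc (z ^ k) = normc z ^ k.
Proof. by case: k => n; rewrite /= /exprz ?NegzE ?normcV normcX. Qed.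

(** With y the imaginary part of g i, |j_{1/2}(g, i)| = y^(-1/4). As k is twice the weight, its
    power -k has absolute value y^(k/4). *)
Lemma normc_whittaker (k : int) (n : R) g :
  normc (@whittaker R (linear_SL2 R) k n g) =
  (bottom_norm g)^-1 `^ (k%:~R / 2%:R / 2%:R) *
  expR (- (2%:R * pi * n * (bottom_norm g)^-1)).
Proof.
have D0 := bottom_norm_gt0 g.
rewrite /whittaker /= SL2_act_i cexp_scaled_i !normcM normc_cis mulr1.
rewrite normc_real ger0_norm ?expR_ge0 //; congr (_ * _).
rewrite normcXz normc_principal_j -powR_intmul ?powR_ge0 // -powRrM.
rewrite -(powR_inv1 (ltW D0)) -powRrM; congr (_ `^ _); rewrite rmorphN /=; by field.
Qed.

Lemma horo_subproof (x r : R) : 0 < r -> \det (mx2 r (x / r) 0 r^-1) == 1.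
Proof. by move=> /lt0r_neq0 r0; rewrite det_mx2 mulr0 subr0 mulfV. Qed.

(* an element of SL_2(R) sending i to x + i r^2 *)
Definition horo (x r : R) (r0 : 0 < r) : SL2 R :=
  exist _ (mx2 r (x / r) 0 r^-1) (horo_subproof x r0).

Lemma bottom_norm_horo x r (r0 : 0 < r) : bottom_norm (horo x r0) = (r ^+ 2)^-1.
Proof. by rewrite /bottom_norm /= !mxE /= expr0n add0r exprVn. Qed.

(** The bottom row (0, 1/r) does not involve x, so the automorphy factor is constant and x enters
    only through the additive character. *)
Lemma whittaker_horo (k : int) (n x r : R) (r0 : 0 < r) :
  @whittaker R (linear_SL2 R) k n (horo x r0) =
  @whittaker R (linear_SL2 R) k n (horo 0 r0) * cis (2%:R * pi * n * x).
Proof.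
have actE z : SL2_act (horo z r0) 'i = z +i* r ^+ 2.
  rewrite SL2_act_i bottom_norm_horo /= !mxE /= mulr0 add0r invrK.
  by congr (_ +i* _); field; rewrite gt_eqF.
have jE : principal_j (horo x r0) 'i = principal_j (horo 0 r0) 'i.
  by rewrite /principal_j /= !mxE.
rewrite /whittaker -[proj_inf _]/(horo x r0) -[proj_inf _]/(horo 0 r0) !actE.
by rewrite !cexp_scaled_i mulr0 cis0 mulr1 /= jE mulrA.
Qed.

End WhittakerNorm.

(** * Elementary bounds for powers and for sums of exponentials *)

Section ExponentialBounds.
Variable R : realType.

Lemma powR_le_expR (L delta : R) : 0 <= L -> 0 < delta ->
  exists2 C : R, 0 < C & forall t, 0 < t -> t `^ L <= C * expR (delta * t).
Proof.
move=> L0 d0; pose s := delta / (L + 1).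
have L1 : 0 < L + 1 by lra.
have s0 : 0 < s by rewrite divr_gt0.
have dE : delta = s * (L + 1) by rewrite /s divfK ?gt_eqF.
(* C = s^(-L), from ln (t s) <= t s multiplied by L; the denominator L + 1 keeps s defined when L =
   0. *)
exists (expR (- (L * ln s))) => [|t t0]; first exact: expR_gt0.
rewrite /powR gt_eqF // -expRD ler_expR.
have ts0 : 0 < t * s by rewrite mulr_gt0.
have := ln_sublinear ts0; rewrite lnM ?posrE // => hln; rewrite dE; nra.
Qed.

Lemma geometric_expR_le (s : R) n : 0 < s ->
  \sum_(0 <= m < n) expR (- (s * m.+1%:R)) <= s^-1.
Proof.
(* The sharper bound (1 - exp(- s n)) / s is the one that passes through the induction, by exp s >=
   1 + s. *)
move=> s0; apply: (@le_trans _ _ ((1 - expR (- (s * n%:R))) / s)); last first.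
  by rewrite ler_pdivrMr // mulVf ?gt_eqF // lerBlDr lerDl expR_ge0.
elim: n => [|n IH]; first by rewrite big_nil mulr0 oppr0 expR0 subrr mul0r.
rewrite big_nat_recr //=; apply: le_trans (lerD IH (lexx _)) _.
rewrite -lerBrDl -mulrBl ler_pdivlMr //.
have -> : expR (- (s * n%:R)) = expR (- (s * n.+1%:R)) * expR s.
  by rewrite -expRD; congr expR; rewrite -natr1; ring.
by have := expR_ge1Dx s; have := expR_gt0 (- (s * n.+1%:R)); nra.
Qed.

Lemma uniq_nat_sum_le (X : seq nat) (f : nat -> R) : uniq X ->
  (forall n, 0 <= f n) -> exists L, \sum_(n <- X) f n <= \sum_(0 <= n < L) f n.
Proof.
move=> uX f0; pose L := (\max_(n <- X) n).+1; exists L.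
have pX : perm_eq X [seq n <- iota 0 L | n \in X].
  apply: uniq_perm => //; first by rewrite filter_uniq ?iota_uniq.
  move=> n; rewrite mem_filter mem_iota /= add0n; case: (boolP (n \in X)) => //= nX.
  by apply/esym; rewrite ltnS; exact: (leq_bigmax_seq (F := id) n nX).
rewrite (perm_big _ pX) big_filter /index_iota subn0 big_mkcond.
by apply: ler_sum => n _; case: ifP.
Qed.

(** The positive terms sit at distinct points (m + 1) / M, so indexing them by m compares the sum
    with a geometric series. *)
Lemma lattice_sum_le (M : nat) (K s : R) (E : {fset rat}) (F : rat -> R) :
  (0 < M)%N -> 0 <= K -> 0 < s ->
  (forall d, F d <= 0 \/
     exists m : nat, d = m.+1%:R / M%:R /\ F d <= K * expR (- (s * m.+1%:R))) ->
  \sum_(d <- E) F d <= K / s.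
Proof.
move=> M0 K0 s0 hF; have Mn0 : M%:R != 0 :> rat by rewrite pnatr_eq0 -lt0n.
pose P (d : rat) := `[< exists m : nat, d = m.+1%:R / M%:R >].
have /choice[nu hnu] : forall d : rat, exists m : nat, P d -> d = m.+1%:R / M%:R.
  move=> d; case: (pselect (exists m : nat, d = m.+1%:R / M%:R)) => [[m ->]|nd].
    by exists m.
  by exists 0%N => /asboolP.
have Fnu d : P d -> F d <= K * expR (- (s * (nu d).+1%:R)).
  move=> Pd; have [F0|[m [dE Fm]]] := hF d.
    by apply: le_trans F0 _; rewrite mulr_ge0 ?expR_ge0.
  suff -> : nu d = m by [].
  apply/eqP; rewrite -eqSS -(eqr_nat rat); apply/eqP.
  by apply: (mulIf (invr_neq0 Mn0)); rewrite -dE -hnu.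
have NF d : ~~ P d -> F d <= 0.
  by move=> /asboolPn nP; have [//|[m [dE _]]] := hF d; case: nP; exists m.
pose X := [seq nu d | d <- enum_fset E & P d].
have uX : uniq X.
  rewrite map_inj_in_uniq ?filter_uniq ?fset_uniq // => d d'.
  rewrite !mem_filter => /andP[Pd _] /andP[Pd' _] nE.
  by rewrite (hnu _ Pd) (hnu _ Pd') nE.
pose f n := K * expR (- (s * n.+1%:R)).
have [L hL] := @uniq_nat_sum_le X f uX (fun n => mulr_ge0 K0 (expR_ge0 _)).
apply: (@le_trans _ _ (\sum_(n <- X) f n)).
  rewrite big_map big_filter [leRHS]big_mkcond /=; apply: ler_sum => d _.
  by case: ifP => [/Fnu|/negbT/NF].
apply: le_trans hL _; rewrite -mulr_sumr ler_wpM2l //.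
exact: geometric_expR_le.
Qed.

End ExponentialBounds.

(** * The absolute value of an automorphic form *)

Section AbsoluteValue.
Variables (R : realType) (k : int).
Variables (Gf : Type) (pf : Gf -> SL2Af) (b : rat -> Gf -> R[i]).
Variables (f : Gf -> SL2 R -> R[i]) (Phi : SL2Af -> SL2 R -> R) (N : nat).

Local Notation lam := (k%:~R / 2%:R / 2%:R : R).
Local Notation W d g := (@whittaker R (linear_SL2 R) k (ratr d) g).

Hypothesis pf_surj : forall h, exists gf, pf gf = h.
Hypothesis fPhi : forall gf g, normc (f gf g) = Phi (pf gf) g.
Hypothesis f_sum : forall gf g,
  unconditional_sum (fun d : rat => if 0 < d then b d gf * W d g else 0) (f gf g).
Hypothesis Phi_left : forall c h g,
  Phi (SL2Af_mul (SL2Af_of_Q c) h) (SL2_mul (SL2_map (@ratr R) c) g) = Phi h g.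
Hypothesis N_gt0 : (0 < N)%N.
Hypothesis Phi_right : forall u h g, congruence_subgroup N u ->
  Phi (SL2Af_mul h u) g = Phi h g.

(** Strong approximation makes the finite part integral; the matrix from reduction theory is
    integral, so it preserves this. *)
Lemma Phi_reduced h g : exists h' g',
  [/\ SL2_Zhat h', bottom_norm g' <= 5 / 3 & Phi h g = Phi h' g'].
Proof.
have [c hc] := SL2_strong_approx h.
have [d id_ hd] := reduction_theory (SL2_mul (SL2_map (@ratr R) c) g).
exists (SL2Af_mul (SL2Af_of_Q d) (SL2Af_mul (SL2Af_of_Q c) h)).
exists (SL2_mul (SL2_map (@ratr R) d) (SL2_mul (SL2_map (@ratr R) c) g)).
split=> //; last by rewrite !Phi_left.
by move=> p; apply: SL2_Zp_mul; [exact: SL2_integral_Zp|exact: hc].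
Qed.

Lemma coef_le (S : R) : (forall h g, Phi h g <= S) ->
  forall d gf y, 0 < d -> 0 < y ->
  normc (b d gf) * (y `^ lam * expR (- (2%:R * pi * ratr d * y))) <= S.
Proof.
move=> hS d gf y d0 y0; have r0 : 0 < Num.sqrt y by rewrite sqrtr_gt0.
pose c (d : rat) := if 0 < d then b d gf * W d (horo 0 r0) else 0.
have w_inj : injective (fun d : rat => 2%:R * pi * ratr d : R).
  have pi2 : 2%:R * pi != 0 :> R by rewrite mulf_neq0 ?pnatr_eq0 // gt_eqF ?pi_gt0.
  by move=> d1 d2 /(mulfI pi2)/fmorph_inj.
have : normc (c d) <= S.
  apply: (@unconditional_coef_le _ _ _ w_inj c (fun x => f gf (horo x r0)) S d) => x.
    rewrite (_ : (fun i : rat => _) =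
      fun d : rat => if 0 < d then b d gf * W d (horo x r0) else 0) //.
    apply: funext => i; rewrite /c; case: ifP => _; last by rewrite mul0r.
    by rewrite [in RHS]whittaker_horo mulrA.
  by rewrite fPhi.
by rewrite /c d0 normcM normc_whittaker bottom_norm_horo invrK sqr_sqrtr ?(ltW y0).
Qed.

Section Support.
Variable M : nat.
Hypothesis M_gt0 : (0 < M)%N.
Hypothesis b_supp : forall d gf, 0 < d -> SL2_Zhat (pf gf) -> b d gf <> 0 ->
  exists n : int, d = n%:~R / M%:R.

Lemma b_supp_nat d gf : 0 < d -> SL2_Zhat (pf gf) -> b d gf <> 0 ->
  exists m : nat, d = m.+1%:R / M%:R.
Proof.
move=> d0 hgf /(b_supp d0 hgf)[[n|n] dE].
  case: n dE => [|n] dE; last by exists n; rewrite dE -pmulrn.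
  by move: d0; rewrite dE mul0r ltxx.
move: d0; rewrite dE NegzE rmorphN mulNr oppr_gt0 ltNge divr_ge0 ?ler0n //.
Qed.

(** The expansion at height y >= 3/5 is compared termwise with the absolutely convergent one at the
    fixed height 3/10. *)
Lemma Phi_bounded_at gf : SL2_Zhat (pf gf) ->
  exists B, forall g, bottom_norm g <= 5 / 3 -> Phi (pf gf) g <= B.
Proof.
move=> hgf; have y10 : 0 < 3 / 10 :> R by lra.
have r0 : 0 < Num.sqrt (3 / 10) :> R by rewrite sqrtr_gt0.
have [B hB] := unconditional_sum_abs_bounded (f_sum gf (horo 0 r0)).
have pi0 := pi_gt0 R; have Mr0 : 0 < M%:R :> R by rewrite ltr0n.
have del0 : 0 < pi * (3 / 10) / M%:R :> R by rewrite divr_gt0 // mulr_gt0.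
have [C C0 hC] := powR_le_expR (normr_ge0 lam) del0.
exists (C * B) => g hg; rewrite -fPhi.
apply: (unconditional_sum_le (E0 := fset0) (f_sum gf g)) => E _.
apply: le_trans (ler_normc_sum _ _ _) _.
apply: le_trans (ler_wpM2l (ltW C0) (hB E)); rewrite mulr_sumr.
apply: ler_sum => d _ /=; case: ifP => d0; last by rewrite normc0 mulr0.
have [->|/eqP bd0] := eqVneq (b d gf) 0; first by rewrite !mul0r normc0 mulr0.
have [m dE] := b_supp_nat d0 hgf bd0.
rewrite !(normcM (b d gf)) mulrCA ler_wpM2l ?normc_ge0 // !normc_whittaker bottom_norm_horo.
rewrite invrK sqr_sqrtr ?(ltW y10) //; set y := (bottom_norm g)^-1.
have D0 := bottom_norm_gt0 g.
have y35 : 3 / 5 <= y.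
  by rewrite /y -[leRHS]mul1r ler_pdivlMr //; lra.
pose t := y / (3 / 10).
have yE : y = t * (3 / 10) by rewrite /t divfK // gt_eqF.
have t2 : 2 <= t by rewrite /t ler_pdivlMr //; lra.
have t0 : 0 < t by lra.
(* The exponent |lam| allows for negative weight; it dominates lam because t >= 1. *)
have tC : t `^ lam <= C * expR (pi * (3 / 10) / M%:R * t).
  by apply: le_trans (hC _ t0); apply: ler_powR; [lra|exact: ler_norm].
rewrite yE powRM ?(ltW t0) ?(ltW y10) //; set u := (3 / 10) `^ lam.
set e1 := expR (pi * _ / _ * _) in tC; set e2 := expR _; set e3 := expR _.
apply: (@le_trans _ _ (C * e1 * u * e2)).
  by rewrite !ler_wpM2r ?expR_ge0 ?powR_ge0.
have -> : C * e1 * u * e2 = C * (u * (e1 * e2)) by ring.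
rewrite !ler_wpM2l ?(ltW C0) ?powR_ge0 // -expRD ler_expR.
have dM : M%:R^-1 <= ratr d :> R.
  by rewrite dE fmorph_div /= !ratr_nat ler_peMl ?invr_ge0 ?ler0n ?ler1n.
have Mi0 : 0 < M%:R^-1 :> R by rewrite invr_gt0.
(* Divided by 3 pi / 10, the inequality of exponents reads t / M <= 2 d (t - 1); it follows from d
   >= 1 / M and t >= 2. *)
have h1 : M%:R^-1 * t <= ratr d * t by rewrite ler_wpM2r ?(ltW t0).
have h2 : ratr d * t <= 2 * ratr d * (t - 1) by nra.
have : 0 <= pi * (2 * ratr d * (t - 1) - M%:R^-1 * t) by rewrite mulr_ge0 ?(ltW pi0) //; lra.
by lra.
Qed.

(** On SL_2(Zhat), [Phi] depends on the finite part only through its class in a finite set, so one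
    representative per nonempty class suffices. *)
Lemma Phi_bounded : exists B, forall h g, Phi h g <= B.
Proof.
have [T [cl hcl]] := congruence_finite_index N_gt0.
have /choice[B hB] : forall tau : T, exists B : R, forall h g, SL2_Zhat h ->
    cl h = tau -> bottom_norm g <= 5 / 3 -> Phi h g <= B.
  move=> tau; case: (pselect (exists2 h, SL2_Zhat h & cl h = tau)); last first.
    by move=> nh; exists 0 => h g hh ch; case: nh; exists h.
  move=> [h0 hh0 ch0]; have [gf gfE] := pf_surj h0.
  have [|B hB] := @Phi_bounded_at gf; first by rewrite gfE.
  exists B => h g hh ch hg; have [|u hu ->] := hcl h0 h hh0 hh; first by rewrite ch0.
  by rewrite Phi_right // -gfE; exact: hB.
exists (\sum_tau `|B tau|) => h g; have [h' [g' [hh' hg' ->]]] := Phi_reduced h g.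
apply: le_trans (hB _ _ _ hh' erefl hg') _; apply: le_trans (ler_norm _) _.
by rewrite (bigD1 (cl h')) //= lerDl sumr_ge0.
Qed.

Lemma coef_neg_weight d gf : k < 0 -> 0 < d -> b d gf = 0.
Proof.
move=> k0 d0; have [S hS] := Phi_bounded.
have L0 : 0 < - lam by rewrite oppr_gt0 !pmulr_llt0 ?invr_gt0 // ltrz0.
apply: eq0_normc; apply/eqP; rewrite eq_le normc_ge0 andbT.
(* For 0 < y < 1 the coefficient is at most K y^(- lam), which tends to 0 with y as - lam > 0.
   Dividing e by K + 1 covers K = 0. *)
pose K := `|S| * expR (2%:R * pi * ratr d).
have K0 : 0 < K + 1 by rewrite ltr_wpDl // mulr_ge0 ?expR_ge0.
apply/ler_addgt0Pl => e e0; rewrite addr0.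
have e1 : 0 < e / (K + 1) by rewrite divr_gt0.
have /cvgrPdist_lt/(_ _ e1) hnear := powR_cvg0 L0.
near (0 : R)^'+ => y.
have y0 : 0 < y by near: y; exact: nbhs_right_gt.
have y1 : y < 1 by near: y; exact: nbhs_right_lt.
have ye : y `^ (- lam) < e / (K + 1).
  rewrite -[ltLHS](ger0_norm (powR_ge0 _ _)) -normrN -sub0r.
  by near: y.
have := coef_le hS gf d0 y0; rewrite -[lam in y `^ lam]opprK powRN expRN.
set v := y `^ (- lam) in ye *; set E := expR _.
have v0 : 0 < v by rewrite powR_gt0.
have E0 : 0 < E by rewrite expR_gt0.
have dr0 : 0 < ratr d :> R by rewrite ltr0q.
have EK : E <= expR (2%:R * pi * ratr d).
  rewrite ler_expR ler_piMr ?(ltW y1) //.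
  by rewrite mulr_ge0 ?(ltW dr0) // mulr_ge0 ?pi_ge0.
rewrite -invfM ler_pdivrMr ?mulr_gt0 // => hb.
apply: le_trans hb _.
apply: (@le_trans _ _ (K * v)).
  rewrite /K [v * E]mulrC mulrA ler_wpM2r ?(ltW v0) //.
  apply: (@le_trans _ _ (`|S| * E)); first by rewrite ler_wpM2r ?ler_norm ?ltW.
  by rewrite ler_wpM2l.
move: ye; rewrite ltr_pdivlMr //; nra.
Unshelve. all: by end_near.
Qed.

(** * The self-improving bound for the supremum *)

Section Main.
Variables (C A eps : R).
Hypothesis C_gt0 : 0 < C.
Hypothesis hC : forall t, 0 < t -> t `^ lam <= C * expR (pi / 6 * t).
Hypothesis hA : 10 * C * expR (2 * pi) <= A.
Hypothesis eps_ge0 : 0 <= eps.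
Local Notation beta d gf := ((ratr d : R) `^ (- lam) * normc (b d gf)).
Hypothesis small : forall d gf, 0 < d -> ratr d < ln M%:R / pi + A ->
  SL2_Zhat (pf gf) -> beta d gf <= eps.

Lemma beta_le_sup (S : R) : (forall h g, Phi h g <= S) ->
  forall d gf, 0 < d -> beta d gf <= S * expR (2 * pi).
Proof.
move=> hS d gf d0; have dr0 : 0 < ratr d :> R by rewrite ltr0q.
have y0 : 0 < (ratr d : R)^-1 by rewrite invr_gt0.
have := coef_le hS gf d0 y0; rewrite (mulfK (lt0r_neq0 dr0)).
have -> : (ratr d)^-1 `^ lam = ratr d `^ (- lam) :> R.
  by rewrite -powR_inv1 ?(ltW dr0) // -powRrM mulN1r.
by rewrite expRN mulrA ler_pdivrMr ?expR_gt0 // [_ * normc _]mulrC.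
Qed.

Lemma Phi_le_half_sup (S : R) : (forall h g, Phi h g <= S) ->
  forall h g, Phi h g <= 5 * C * M%:R * eps + S / 2.
Proof.
move=> hS h0 g0; have [h [g [hh hg ->]]] := Phi_reduced h0 g0.
have S0 : 0 <= S.
  have [gf gfE] := pf_surj h; apply: le_trans (hS h g).
  by rewrite -gfE -fPhi normc_ge0.
have [gf gfE] := pf_surj h; rewrite -gfE in hh *; rewrite -fPhi.
have pi0 := pi_gt0 R; have pi2 := pi_ge2 R.
have Mr0 : 0 < M%:R :> R by rewrite ltr0n.
pose r := ln M%:R / pi + A.
(* Q bounds |beta_d| exp(- pi d): by eps below the cutoff r, and by S exp(2 pi) exp(- pi r) from r
   on. *)
pose Q := eps + S * expR (2 * pi) * expR (- (pi * r)).
have Q0 : 0 <= Q by rewrite addr_ge0 // !mulr_ge0 ?expR_ge0.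
have s0 : 0 < pi / 10 / M%:R :> R by rewrite !divr_gt0.
apply: (@le_trans _ _ (C * Q / (pi / 10 / M%:R))).
  apply: (unconditional_sum_le (E0 := fset0) (f_sum gf g)) => E _.
  apply: le_trans (ler_normc_sum _ _ _) _.
  apply: (lattice_sum_le (M := M)) => //; first by rewrite mulr_ge0 // ltW.
  move=> d; case: ifP => d0; last by left; rewrite normc0.
  have [->|/eqP bd0] := eqVneq (b d gf) 0; first by left; rewrite mul0r normc0.
  right; have [m dE] := b_supp_nat d0 hh bd0; exists m; split=> //.
  have dr0 : 0 < ratr d :> R by rewrite ltr0q.
  have -> : pi / 10 / M%:R * m.+1%:R = pi / 10 * ratr d :> R.
    by rewrite dE fmorph_div /= !ratr_nat; ring.
  rewrite (normcM (b d gf)) normc_whittaker; set y := (bottom_norm g)^-1.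
  have D0 := bottom_norm_gt0 g.
  have y35 : 3 / 5 <= y by rewrite /y -[leRHS]mul1r ler_pdivlMr //; lra.
  have y0 : 0 < y by lra.
  have dy0 : 0 < ratr d * y by rewrite mulr_gt0.
  have -> : normc (b d gf) * (y `^ lam * expR (- (2%:R * pi * ratr d * y))) =
      beta d gf * ((ratr d * y) `^ lam * expR (- (2%:R * pi * ratr d * y))).
    rewrite (powRM _ (ltW dr0) (ltW y0)) powRN; field.
    by rewrite gt_eqF // powR_gt0.
  have beta0 : 0 <= beta d gf by rewrite mulr_ge0 ?powR_ge0 ?normc_ge0.
  have betaQ : beta d gf * expR (- (pi * ratr d)) <= Q.
    have [dr|dr] := ltP (ratr d) r.
      apply: (@le_trans _ _ eps); last by rewrite lerDl !mulr_ge0 ?expR_ge0.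
      apply: le_trans (small d0 dr hh); rewrite ler_piMr // expR_le1.
      by rewrite oppr_le0 mulr_ge0 // ltW.
    apply: (@le_trans _ _ (S * expR (2 * pi) * expR (- (pi * r)))); last by rewrite lerDr.
    apply: ler_pM => //; rewrite ?expR_ge0 //; first exact: beta_le_sup.
    by rewrite ler_expR lerN2 ler_wpM2l // ltW.
  apply: (@le_trans _ _ (beta d gf * (C * expR (- (pi * ratr d) - pi / 10 * ratr d)))).
    rewrite ler_wpM2l //.
    apply: (@le_trans _ _ (C * expR (pi / 6 * (ratr d * y)) *
                           expR (- (2%:R * pi * ratr d * y)))).
      by rewrite ler_wpM2r ?expR_ge0 // hC.
    rewrite -mulrA ler_wpM2l ?(ltW C_gt0) // -expRD ler_expR.
    (* Here 2 - 1/6 = 11/6 and (11/6)(3/5) = 1 + 1/10: one part pi d goes into Q, and pi d / 10 is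
       left for the sum over the lattice. *)
    have y35' : 0 <= y - 3 / 5 by lra.
    by have := mulr_ge0 (ltW (mulr_gt0 pi0 dr0)) y35'; lra.
  have -> : beta d gf * (C * expR (- (pi * ratr d) - pi / 10 * ratr d)) =
      C * (beta d gf * expR (- (pi * ratr d))) * expR (- (pi / 10 * ratr d)).
    by rewrite expRD; ring.
  by rewrite ler_wpM2r ?expR_ge0 // ler_wpM2l // ltW.
(* The term log(M) / pi of the cutoff yields a factor 1 / M, which cancels the M coming from the sum
   over M^-1 Z. *)
have Mi : expR (- (pi * r)) = M%:R^-1 * expR (- (pi * A)).
  by rewrite /r mulrDr [pi * (_ / _)]mulrC divfK ?gt_eqF // opprD expRD (expRN (ln _)) lnK ?posrE.
(* 10 C exp(2 pi) <= A <= 1 + pi A <= exp(pi A). *)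
have decay : 10 * C * expR (2 * pi) * expR (- (pi * A)) <= 1.
  rewrite expRN ler_pdivrMr ?expR_gt0 // mul1r; apply: le_trans hA _.
  have A0 : 0 <= A by apply: le_trans hA; rewrite !mulr_ge0 ?expR_ge0 ?(ltW C_gt0).
  by have := expR_ge1Dx (pi * A); nra.
have E (x m c q : R) : x != 0 -> m != 0 -> c * q / (x / 10 / m) = 10 / x * (c * m * q).
  by move=> x0 m0; field; rewrite x0 m0.
rewrite E ?lt0r_neq0 //.
have p5 : 10 / pi <= 5 :> R by rewrite ler_pdivrMr //; lra.
have CMQ : 0 <= C * M%:R * Q by rewrite !mulr_ge0 // ltW.
apply: le_trans (ler_wpM2r CMQ p5) _.
have -> : 5 * (C * M%:R * Q) = 5 * C * M%:R * eps +
    S / 2 * (10 * C * expR (2 * pi) * expR (- (pi * A))).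
  by rewrite /Q Mi; field; rewrite gt_eqF.
by rewrite lerD2l ler_piMr // divr_ge0.
Qed.

(** For S the supremum of [Phi], finite by boundedness, S <= 5 C M eps + S / 2 gives S <= 10 C M
    eps, which is inserted into |beta_d| <= S exp(2 pi). *)
Lemma beta_le d gf : 0 < d -> beta d gf <= eps * (10 * C * expR (2 * pi)) * M%:R.
Proof.
move=> d0; have [B hB] := Phi_bounded.
pose V := [set x | exists h g, x = Phi h g].
have supV : has_sup V.
  split; first by exists (Phi SL2Af_one (SL2_one R)), SL2Af_one, (SL2_one R).
  by exists B => _ [h [g ->]].
have hS h g : Phi h g <= sup V by apply: sup_upper_bound => //; exists h, g.
have : sup V <= 5 * C * M%:R * eps + sup V / 2.
  by apply: ge_sup => [|_ [h [g ->]]]; [exact: supV.1|exact: Phi_le_half_sup].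
move=> le_half; have le10 : sup V <= 10 * C * M%:R * eps by lra.
apply: le_trans (beta_le_sup hS gf d0) _.
by have := ler_wpM2r (expR_ge0 (2 * pi)) le10; lra.
Qed.

End Main.
End Support.
End AbsoluteValue.

(** * Passage to the linear and metaplectic adelic groups *)

Lemma unconditional_sum_uniq (R : realType) (I : choiceType) (a : I -> R[i]) l l' :
  unconditional_sum a l -> unconditional_sum a l' -> l = l'.
Proof.
move=> sl sl'; apply/eqP; rewrite -subr_eq0; apply/eqP/eq0_normc/eqP.
rewrite eq_le normc_ge0 andbT; apply/ler_addgt0Pl => e e0; rewrite addr0.
have e2 : 0 < e / 2 by rewrite divr_gt0.
have [E1 hE1] := sl _ e2; have [E2 hE2] := sl' _ e2.
have h1 := hE1 _ (fsubsetUl E1 E2); have h2 := hE2 _ (fsubsetUr E1 E2).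
set T := \sum_(i <- _) _ in h1 h2.
have -> : l - l' = (l - T) - (l' - T) by ring.
by apply: le_trans (ler_normcD _ _) _; rewrite normcN; lra.
Qed.

Lemma unconditional_sumZ (R : realType) (I : choiceType) (a : I -> R[i]) l c :
  normc c = 1 -> unconditional_sum a l -> unconditional_sum (fun i => c * a i) (c * l).
Proof.
move=> c1 sl e e0; have [E0 hE0] := sl _ e0; exists E0 => E /hE0.
by rewrite -mulr_sumr -mulrBr normcM c1 mul1r.
Qed.

Section LiftedWhittaker.
Variables (R : realType) (t : adelic_kind).
Local Notation G := (adelic_SL2 R t).

Lemma proj_fin_lift h : proj_fin (lift_fin G h) = h.
Proof. by case: t. Qed.

Lemma proj_fin_surj h : exists gf : Gfin G, proj_fin gf = h.
Proof. by exists (lift_fin G h); exact: proj_fin_lift. Qed.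

Lemma proj_inf_lift g : proj_inf (lift_inf G g) = g.
Proof. by case: t. Qed.

Lemma whittaker_lift k n g :
  whittaker k n (lift_inf G g) = @whittaker R (linear_SL2 R) k n g.
Proof. by case: t; rewrite /whittaker /= ?expr0 ?mul1r. Qed.

End LiftedWhittaker.

(* The Fourier expansion forces phi to be multiplied by the sign (-1)^k under the
   nontrivial central element. *)
Lemma metaplectic_abs_sign (R : realType) (k : int)
    (phi : Gad (metaplectic_SL2 R) -> R[i]) (b : rat -> Gfin (metaplectic_SL2 R) -> R[i])
    h g u :
  fourier_expansion k phi b -> normc (phi ((h, g), u)) = normc (phi ((h, g), false)).
Proof.
move=> phi_exp; case: u => //.
(* Signs are identified along the diagonal, so the sign can be placed on the real factor, where the
   Whittaker function sees it. *)
have s2 := unconditional_sum_cvg (@phi_exp (h, false) (g, true)).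
have s1 := unconditional_sum_cvg (@phi_exp (h, false) (g, false)).
pose c : R[i] := (-1) ^ (- k).
have c1 : normc c = 1 by rewrite normcXz normcN normc1 exp1rz.
rewrite -[RHS]mul1r -c1 -normcM; congr normc.
apply: unconditional_sum_uniq s2 _.
suff -> : (fun d : rat => if 0 < d
      then b d (h, false) * whittaker k (ratr d) ((g, true) : Ginf (metaplectic_SL2 R))
      else 0) =
    (fun d : rat => c * (if 0 < d
      then b d (h, false) * whittaker k (ratr d) ((g, false) : Ginf (metaplectic_SL2 R))
      else 0)) by exact: unconditional_sumZ.
apply: funext => d.
case: (0 < d); last first.
  by rewrite mulr0.
rewrite /whittaker /= expr0 expr1 mul1r expfzMl -/c.
move: (b d _) (principal_j _ _ ^ _) (cexp _) => x y z.
by rewrite -mulrA mulrCA.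
Qed.

Section AdelicAbsoluteValue.
Variables (R : realType) (k : int) (t : adelic_kind).
Local Notation G := (adelic_SL2 R t).
Variables (phi : Gad G -> R[i]) (b : rat -> Gfin G -> R[i]).
Hypothesis phi_exp : fourier_expansion k phi b.

(** The sections need not be homomorphisms: they fail to be so only by a sign, which the absolute
    value ignores once [phi] has a Fourier expansion. *)
Definition adelic_abs (h : SL2Af) (g : SL2 R) : R :=
  normc (phi (adjoin (lift_fin G h) (lift_inf G g))).

Lemma adelic_sum gf g : unconditional_sum
  (fun d : rat => if 0 < d
     then b d gf * @whittaker R (linear_SL2 R) k (ratr d) g else 0)
  (phi (adjoin gf (lift_inf G g))).
Proof.
have := unconditional_sum_cvg (@phi_exp gf (lift_inf G g)).
rewrite (_ : (fun d : rat => _) = fun d : rat => if 0 < d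
   then b d gf * @whittaker R (linear_SL2 R) k (ratr d) g else 0) //.
by apply: funext => d; rewrite whittaker_lift.
Qed.

End AdelicAbsoluteValue.

Lemma adelic_absE (R : realType) (k : int) (t : adelic_kind)
    (phi : Gad (adelic_SL2 R t) -> R[i]) b gf gi : fourier_expansion k phi b ->
  normc (phi (adjoin gf gi)) = adelic_abs phi (proj_fin gf) (proj_inf gi).
Proof.
case: t phi b gf gi => [|] phi b; first by move=> gf gi _; reflexivity.
move=> [h s] [g s'] phi_exp.
rewrite /adelic_abs -[LHS]/(normc (phi ((h, g), s (+) s'))).
exact: metaplectic_abs_sign phi_exp.
Qed.

(** The cocycles in the metaplectic product change only the sign component. *)
Lemma adelic_abs_gmul (R : realType) (k : int) (t : adelic_kind)
    (phi : Gad (adelic_SL2 R t) -> R[i]) b gf gi gf' gi' : fourier_expansion k phi b ->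
  normc (phi (gmul (adjoin gf gi) (adjoin gf' gi'))) =
  adelic_abs phi (SL2Af_mul (proj_fin gf) (proj_fin gf'))
                 (SL2_mul (proj_inf gi) (proj_inf gi')).
Proof.
case: t phi b gf gi gf' gi' => [|] phi b; first by move=> gf gi gf' gi' _; reflexivity.
move=> [h s] [g s'] [h' u] [g' u'] phi_exp; rewrite /adelic_abs.
exact: metaplectic_abs_sign phi_exp.
Qed.

Section Invariance.
Variables (R : realType) (k : int) (t : adelic_kind).
Local Notation G := (adelic_SL2 R t).
Variables (phi : Gad G -> R[i]) (b : rat -> Gfin G -> R[i]).
Hypothesis phi_exp : fourier_expansion k phi b.
Hypothesis phi_auto : automorphic_form phi.

Lemma adelic_abs_left c h g :
  adelic_abs phi (SL2Af_mul (SL2Af_of_Q c) h) (SL2_mul (SL2_map (@ratr R) c) g)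
  = adelic_abs phi h g.
Proof.
case: phi_auto => -[s [_ sE] phi_s] _ _ _ _.
have [gf [gi [scE gfE giE]]] := sE c.
rewrite [RHS]/adelic_abs -(phi_s c) scE (adelic_abs_gmul _ _ _ _ phi_exp).
by rewrite gfE giE proj_fin_lift proj_inf_lift.
Qed.

Lemma adelic_abs_right : exists2 N, (0 < N)%N & forall u h g,
  congruence_subgroup N u -> adelic_abs phi (SL2Af_mul h u) g = adelic_abs phi h g.
Proof.
case: phi_auto => _ [N N0 phi_N] _ _ _; exists (4 * N)%N; first by rewrite muln_gt0.
move=> u h g hu; rewrite [RHS]/adelic_abs -(phi_N u hu).
rewrite (adelic_abs_gmul _ _ _ _ phi_exp) !proj_fin_lift !proj_inf_lift.
by congr adelic_abs; apply: val_inj; rewrite /= mulmx1.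
Qed.

End Invariance.

(* the weight is k / 2 *)
Theorem theorem12p2 (R : realType) (k : int) :
  exists A B : R, [/\ 0 < A, 0 < B &
    forall (t : adelic_kind)
      (phi : Gad (adelic_SL2 R t) -> R[i])
      (b : rat -> Gfin (adelic_SL2 R t) -> R[i]),
    automorphic_form phi -> cuspidal phi -> fourier_expansion k phi b ->
    forall M : nat, (1 <= M)%N ->
    (forall d : rat, 0 < d ->
       (exists2 kappa, Ktilde kappa & b d kappa <> 0) ->
       exists n : int, d = n%:~R / M%:R) ->
    forall eps : R, 0 <= eps ->
    (forall d : rat, 0 < d -> ratr d < ln M%:R / pi + A ->
       forall kappa, Ktilde kappa -> `|normalized_coef k b d kappa| <= eps%:C) ->
    forall d : rat, 0 < d -> forall gf : Gfin (adelic_SL2 R t),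
      `|normalized_coef k b d gf| <= (eps * B * M%:R)%:C].
Proof.
pose lam := k%:~R / 2%:R / 2%:R : R.
have pi6 : 0 < pi / 6 :> R by rewrite divr_gt0 ?pi_gt0.
have [C C0 hC] := powR_le_expR (normr_ge0 lam) pi6.
have B0 : 0 < 10 * C * expR (2 * pi) :> R by rewrite !mulr_gt0 ?expR_gt0.
(* C depends only on k, and one value serves for both constants: it is the factor in the final bound
   and the smallest A that [hA] admits. *)
exists (10 * C * expR (2 * pi)), (10 * C * expR (2 * pi)); split=> //.
move=> t phi b phi_auto _ phi_exp M M0 supp eps eps0 small d d0 gf.
have normE d' gf' : `|normalized_coef k b d' gf'| =
    (ratr d' `^ (- lam) * normc (b d' gf'))%:C.
  by rewrite normC_def normcM normc_real ger0_norm ?powR_ge0.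
rewrite normE lecR.
have [N N0 right] := adelic_abs_right phi_exp phi_auto.
have left := adelic_abs_left phi_exp phi_auto.
have supp' d' gf' : 0 < d' -> SL2_Zhat (proj_fin gf') -> b d' gf' <> 0 ->
    exists n : int, d' = n%:~R / M%:R.
  by move=> d'0 hgf' bd'; apply: supp => //; exists gf'.
have absE gf' g : normc (phi (adjoin gf' (lift_inf _ g))) =
    adelic_abs phi (proj_fin gf') g.
  by rewrite (adelic_absE _ _ phi_exp) proj_inf_lift.
(* The power bound was taken for |lam|, which is lam when k >= 0; for k < 0 all coefficients
   vanish. *)
have [k0|k0] := ltP k 0.
  rewrite (coef_neg_weight (@proj_fin_surj R t) absE (adelic_sum phi_exp) left N0 right
    M0 supp') // normc0 mulr0.
  by rewrite !mulr_ge0 // ltW.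
have lam0 : 0 <= lam by rewrite !divr_ge0 ?ler0z.
rewrite (ger0_norm lam0) in hC.
apply: (beta_le (@proj_fin_surj R t) absE (adelic_sum phi_exp) left N0 right
  M0 supp' C0 hC (lexx _) eps0 _ gf d0) => d' gf' d'0 ltr hgf'.
by rewrite -lecR -normE; exact: small.
Qed.
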